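(* Let $(M,J,[\nabla])$ be a complex projective surface with Cartan geometry $(\pi:B\to M,\theta)$ and let $W^i_{kl\bar\jmath}$ be the associated complex projective Weyl curvature functions on $B$. A necessary condition for $(M,J,[\nabla])$ to be Kähler metrisable is that the linear system $$\overline{h_{j\bar s}}\,W^s_{ik\bar l}+\overline{h_{l\bar s}}\,W^s_{ik\bar\jmath}=h_{k\bar s}\,\overline{W^s_{jl\bar\imath}}+h_{i\bar s}\,\overline{W^s_{jl\bar k}}\qquad (i,j,k,l\in\{1,2\})$$ admits a nondegenerate solution $\overline{h_{i\bar\jmath}}=h_{j\bar\imath}$, that is, a solution with $h_{1\bar1}h_{2\bar2}-|h_{1\bar2}|^2\neq0$.
   Context: Complex projective surfaces. $M$ is a complex $2$-manifold with integrable almost complex structure $J$. A complex-linear connection is an affine torsion-free connection $\nabla$ on $TM$ with $\nabla J=0$. A generalised geodesic of $\nabla$ is a smoothly immersed curve $\gamma\subset M$ such that the $2$-plane spanned by $\dot\gamma$ and $J\dot\gamma$ is parallel along $\gamma$, i.e. $\nabla_{\dot\gamma}\dot\gamma\wedge\dot\gamma\wedge J\dot\gamma=0$. Two complex-linear torsion-free connections are complex projectively equivalent if they have the same generalised geodesics; an equivalence class $[\nabla]$ is a complex projective structure, and $(M,J,[\nabla])$ is a complex projective surface. It is Kähler metrisable if $[\nabla]$ arises via the Levi-Civita connection of a (pseudo-)Kähler metric on $(M,J)$, i.e. if some (pseudo-)Kähler metric has Levi-Civita connection belonging to $[\nabla]$. Indices $i,j,k,l,s,\dots$ run over $\{1,2\}$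 and repeated indices are summed. The unknowns $h_{i\bar\jmath}$ are complex-valued functions on $B$. In local holomorphic coordinates $z=(z^1,z^2):U\to\mathbb{C}^2$ the complex Christoffel symbols are defined by $\nabla_{\partial_{z^j}}\partial_{z^k}=\Gamma^i_{jk}\partial_{z^i}$, and $$\Pi^i_{jk}=\Gamma^i_{jk}-\tfrac13\left(\Gamma^l_{lj}\delta^i_k+\Gamma^l_{lk}\delta^i_j\right)$$ depends only on $[\nabla]$ and the coordinates $z$. Cartan geometry (known fact). Let $P\subset \mathrm{PSL}(3,\mathbb{C})$ be the stabiliser of $[1,0,0]^t\in\mathbb{CP}^2$. There is, up to isomorphism, a unique real Cartan geometry $(\pi:B\to M,\theta)$ of type $(\mathrm{PSL}(3,\mathbb{C}),P)$, with $\theta=(\theta^a_b)_{a,b=0,1,2}$ (row index $a$, column index $b$, $\theta$ trace-free), such that for every local holomorphic coordinate system $z$ on $U\subset M$ there is a unique section $\sigma_z:U\to B$ with $\sigma_z^*\theta^0_0=0$, $\sigma_z^*\theta^i_0=\mathrm{d}z^i$, $\sigma_z^*\theta^i_j=\Pi^i_{jk}\mathrm{d}z^k$, $\sigma_z^*\theta^0_i=\Pi_{ik}\mathrm{d}z^k$, where $\Pi_{ij}=\Pi^k_{il}\Pi^l_{jk}-\partial\Pi^k_{ij}/\partial z^k$. Curvature. $\Theta=\mathrm{d}\theta+\theta\wedge\theta$ satisfies $\Theta^0_0=\Theta^i_0=0$ and $$\Theta^0_i=L_i\,\theta^1_0\wedge\theta^2_0+K_{il\bar\jmath}\,\theta^l_0\wedge\overline{\theta^j_0},\qquad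 \Theta^i_k=W^i_{kl\bar\jmath}\,\theta^l_0\wedge\overline{\theta^j_0}$$ for unique complex-valued functions $L_i,K_{il\bar\jmath},W^i_{kl\bar\jmath}$ on $B$ with $W^l_{li\bar\jmath}=0$ and $W^i_{kl\bar\jmath}=W^i_{lk\bar\jmath}$. In local holomorphic coordinates $\sigma_z^*W^i_{kl\bar\jmath}=-\partial\Pi^i_{kl}/\partial\bar z^j$. *)

(* Defs.v *)
From HB Require Import structures.
From mathcomp Require Import all_boot all_order all_algebra.
From mathcomp Require Import complex.
From mathcomp Require Import all_classical all_reals all_analysis.

Set Implicit Arguments.
Unset Strict Implicit.
Unset Printing Implicit Defensive.

Import Order.TTheory GRing.Theory Num.Theory.
Import numFieldNormedType.Exports.

Local Open Scope classical_set_scope.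
Local Open Scope ring_scope.

(* Conventions.  Manifolds are Hausdorff, second countable topological spaces
   with an atlas; tensors, connections and forms are given by their components
   in each chart of the atlas together with the transformation law under a
   change of chart.  A tangent vector is a row of components in a chart.  All
   data are of class C^oo.  The record [chart] only carries data, and the
   values of [fwd] and [bwd] are meaningful on [chart_dom] and [chart_image] only. *)

Section Smooth.
Context {R : realType}.
Local Notation C := R[i].

(* The predicates of this section are meant for open sets U of a
   finite-dimensional space V. *)
Fixpoint ck (V : normedModType R) (k : nat) (U : set V) (f : V -> R) : Prop :=
  (forall x, U x -> {for x, continuous f}) /\
  (if k is k'.+1 then
     forall v : V, (forall x, U x -> derivable f x v) /\ ck k' U ('D_v f)
   else True).

Definition smooth_on (V : normedModType R) (U : set V) (f : V -> R) : Prop :=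
  forall k, ck k U f.

Definition smooth_mx (V : normedModType R) m n (U : set V)
    (f : V -> 'M[R]_(m, n)) : Prop :=
  forall i j, smooth_on U (fun x => f x i j).

Definition smooth_cmx (V : normedModType R) m n (U : set V)
    (f : V -> 'M[C]_(m, n)) : Prop :=
  forall i j, smooth_on U (fun x => complex.Re (f x i j)) /\
              smooth_on U (fun x => complex.Im (f x i j)).

Definition Dc (V : normedModType R) (v : V) (f : V -> C) (x : V) : C :=
  Complex ('D_v (fun y => complex.Re (f y)) x)
          ('D_v (fun y => complex.Im (f y)) x).

Definition Dcmx (V : normedModType R) m n (v : V) (f : V -> 'M[C]_(m, n))
    (x : V) : 'M[C]_(m, n) :=
  \matrix_(i, j) Dc v (fun y => f y i j) x.

End Smooth.

Section Manifolds.
Context {R : realType}.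
Local Notation C := R[i].

Record chart (n : nat) (X : topologicalType) := Chart {
  chart_dom : set X;
  fwd : X -> 'rV[R]_n;
  bwd : 'rV[R]_n -> X }.

Definition chart_image n (X : topologicalType) (phi : chart n X) : set 'rV[R]_n :=
  fwd phi @` chart_dom phi.

Definition is_chart n (X : topologicalType) (phi : chart n X) : Prop :=
  [/\ open (chart_dom phi), open (chart_image phi),
      forall p, chart_dom phi p -> bwd phi (fwd phi p) = p,
      forall p, chart_dom phi p -> {for p, continuous (fwd phi)}
    & forall x, chart_image phi x -> {for x, continuous (bwd phi)}].

Definition transition n (X : topologicalType) (phi psi : chart n X) :
    'rV[R]_n -> 'rV[R]_n :=
  fwd psi \o bwd phi.

Definition overlap n (X : topologicalType) (phi psi : chart n X) :
    set 'rV[R]_n :=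
  fwd phi @` (chart_dom phi `&` chart_dom psi).

Record manifold (n : nat) := Manifold {
  carrier :> topologicalType;
  atlas : set (chart n carrier);
  mfd_hausdorff : hausdorff_space carrier;
  mfd_countable : @second_countable carrier;
  atlas_chart : forall phi, atlas phi -> is_chart phi;
  atlas_cover : forall p : carrier, exists2 phi, atlas phi & chart_dom phi p;
  atlas_smooth : forall phi psi, atlas phi -> atlas psi ->
    smooth_mx (overlap phi psi) (transition phi psi) }.

Definition smooth_map m n (M : manifold m) (N : manifold n) (U : set M)
    (f : M -> N) : Prop :=
  (forall p, U p -> {for p, continuous f}) /\
  forall phi psi, atlas phi -> atlas psi ->
    smooth_mx (fwd phi @` (U `&` chart_dom phi `&` f @^-1` chart_dom psi))
      (fwd psi \o f \o bwd phi).

Definition smooth_into (V : normedModType R) n (N : manifold n) (U : set V)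
    (f : V -> N) : Prop :=
  (forall p, U p -> {for p, continuous f}) /\
  forall psi, atlas psi ->
    smooth_mx (U `&` f @^-1` chart_dom psi) (fwd psi \o f).

Definition smooth_cmx_fun n (M : manifold n) (U : set M) a b
    (f : M -> 'M[C]_(a, b)) : Prop :=
  forall phi, atlas phi ->
    smooth_cmx (fwd phi @` (U `&` chart_dom phi)) (f \o bwd phi).

End Manifolds.
Arguments chart R n X : clear implicits.
Arguments manifold R n : clear implicits.

Section ComplexSurfaces.
Context {R : realType}.
Local Notation C := R[i].

(* C^2 is R^(2+2) with z^k = x^k + i y^k, where x^k is the coordinate of index
   [lshift 2 k] and y^k the coordinate of index [rshift 2 k]. *)
Definition Jv (u : 'rV[R]_(2 + 2)) : 'rV[R]_(2 + 2) :=
  row_mx (- rsubmx u) (lsubmx u).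

Definition dz (k : 'I_2) (u : 'rV[R]_(2 + 2)) : C :=
  Complex (u 0 (lshift 2 k)) (u 0 (rshift 2 k)).

Definition holomorphic_on (U : set 'rV[R]_(2 + 2))
    (T : 'rV[R]_(2 + 2) -> 'rV[R]_(2 + 2)) : Prop :=
  smooth_mx U T /\ forall x u, U x -> 'D_(Jv u) T x = Jv ('D_u T x).

(* The atlas is the set of all local holomorphic coordinate systems; J is
   given by [Jv] in each of them. *)
Record complex_surface := ComplexSurface {
  surf_mfd :> manifold R (2 + 2);
  surf_holo : forall phi psi : chart R (2 + 2) surf_mfd,
    atlas phi -> atlas psi -> holomorphic_on (overlap phi psi) (transition phi psi);
  surf_max : forall phi : chart R (2 + 2) surf_mfd, is_chart phi ->
    (forall psi, atlas psi -> holomorphic_on (overlap phi psi) (transition phi psi)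
                           /\ holomorphic_on (overlap psi phi) (transition psi phi)) ->
    atlas phi }.

(* Wirtinger derivatives: d/dz^k = (d/dx^k - i d/dy^k) / 2. *)
Definition dz_vec (k : 'I_2) (a : 'I_(2 + 2)) : C :=
  ((a == lshift 2 k)%:R - Complex 0 1 * (a == rshift 2 k)%:R) / 2%:R.

Definition Dz (k : 'I_2) (f : 'rV[R]_(2 + 2) -> C) (x : 'rV[R]_(2 + 2)) : C :=
  \sum_a dz_vec k a * Dc (delta_mx 0 a) f x.

End ComplexSurfaces.
Arguments complex_surface R : clear implicits.

Section Connections.
Context {R : realType}.
Local Notation C := R[i].

(* From components [G phi x a b c], in the chart phi, to the bilinear map
   (u, v) |-> (covariant derivative along u of the constant field v). *)
Definition cov_of n (X : topologicalType)
    (G : chart R n X -> 'rV[R]_n -> 'I_n -> 'I_n -> 'I_n -> R)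
    (phi : chart R n X) (x u v : 'rV[R]_n) : 'rV[R]_n :=
  \row_a \sum_b \sum_c u 0 b * v 0 c * G phi x a b c.

Record connection n (M : manifold R n) := Connection {
  christoffel : chart R n M -> 'rV[R]_n -> 'I_n -> 'I_n -> 'I_n -> R;
  christoffel_smooth : forall phi a b c, atlas phi ->
    smooth_on (chart_image phi) (fun x => christoffel phi x a b c);
  christoffel_trans : forall phi psi x u v, atlas phi -> atlas psi ->
    overlap phi psi x ->
    'D_(cov_of christoffel phi x u v) (transition phi psi) x =
      'D_u ('D_v (transition phi psi)) x +
      cov_of christoffel psi (transition phi psi x)
        ('D_u (transition phi psi) x) ('D_v (transition phi psi) x) }.

Definition cov n (M : manifold R n) (nabla : connection M) :=
  cov_of (christoffel nabla).

Definition torsion_free n (M : manifold R n) (nabla : connection M) : Prop :=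
  forall phi x u v, atlas phi -> chart_image phi x ->
    cov nabla phi x u v = cov nabla phi x v u.

Variable M : complex_surface R.

Definition complex_linear (nabla : connection M) : Prop :=
  torsion_free nabla /\
  forall phi x u v, atlas phi -> chart_image phi x ->
    cov nabla phi x u (Jv v) = Jv (cov nabla phi x u v).

(* The components of u /\ v /\ w are the 3 x 3 minors. *)
Definition wedge3 n (u v w : 'rV[R]_n) (f : 'I_(1 + (1 + 1)) -> 'I_n) : R :=
  \det (colsub f (col_mx u (col_mx v w))).

Definition generalised_geodesic (nabla : connection M) (I : set R)
    (gamma : R -> M) : Prop :=
  smooth_into I gamma /\
  forall t phi, I t -> atlas phi -> chart_dom phi (gamma t) ->
    let c := fwd phi \o gamma in
    let v := 'D_1 c t in
    let a := 'D_1 ('D_1 c) t + cov nabla phi (c t) v v in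
    v <> 0 /\ forall f, wedge3 a v (Jv v) f = 0.

Definition cproj_equivalent (nabla nabla' : connection M) : Prop :=
  forall (I : set R) (gamma : R -> M), open I -> is_interval I ->
    generalised_geodesic nabla I gamma <-> generalised_geodesic nabla' I gamma.

Definition cproj_structure (S : set (connection M)) : Prop :=
  exists nabla, complex_linear nabla /\
    S = [set nabla' | complex_linear nabla' /\ cproj_equivalent nabla nabla'].

Definition bil (g : 'M[R]_(2 + 2)) (u v : 'rV[R]_(2 + 2)) : R :=
  (u *m g *m v^T) 0 0.

Definition fund_form (g : chart R (2 + 2) M -> 'rV[R]_(2 + 2) -> 'M[R]_(2 + 2))
    phi u v x : R :=
  bil (g phi x) (Jv u) v.

(* Indefinite signature is allowed. *)
Record kahler_metric := KahlerMetric {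
  metric : chart R (2 + 2) M -> 'rV[R]_(2 + 2) -> 'M[R]_(2 + 2);
  metric_smooth : forall phi, atlas phi ->
    smooth_mx (chart_image phi) (metric phi);
  metric_tr : forall phi x, atlas phi -> chart_image phi x ->
    (metric phi x)^T = metric phi x;
  metric_nondeg : forall phi x, atlas phi -> chart_image phi x ->
    metric phi x \in unitmx;
  metric_trans : forall phi psi x u v, atlas phi -> atlas psi ->
    overlap phi psi x ->
    bil (metric psi (transition phi psi x))
      ('D_u (transition phi psi) x) ('D_v (transition phi psi) x) =
    bil (metric phi x) u v;
  metric_hermitian : forall phi x u v, atlas phi -> chart_image phi x ->
    bil (metric phi x) (Jv u) (Jv v) = bil (metric phi x) u v;
  metric_closed : forall phi x u v w, atlas phi -> chart_image phi x ->
    'D_u (fund_form metric phi v w) x + 'D_v (fund_form metric phi w u) x +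
    'D_w (fund_form metric phi u v) x = 0 }.

Definition levi_civita (g : kahler_metric) (nabla : connection M) : Prop :=
  torsion_free nabla /\
  forall phi x u v w, atlas phi -> chart_image phi x ->
    'D_w (fun y => bil (metric g phi y) u v) x =
    bil (metric g phi x) (cov nabla phi x w u) v +
    bil (metric g phi x) u (cov nabla phi x w v).

Definition kahler_metrisable (S : set (connection M)) : Prop :=
  exists g nabla, levi_civita g nabla /\ S nabla.

(* For a complex-linear torsion-free connection the covariant derivative of
   d/dz^k along d/dz^j is of type (1,0), so its dz^i-components determine it. *)
Definition cchristoffel (nabla : connection M) (z : chart R (2 + 2) M)
    (i j k : 'I_2) (x : 'rV[R]_(2 + 2)) : C :=
  \sum_a \sum_b \sum_c dz i (delta_mx 0 a) * dz_vec j b * dz_vec k c *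
    ((christoffel nabla z x a b c)%:C)%C.

Definition Pi3 (nabla : connection M) z (i j k : 'I_2) x : C :=
  cchristoffel nabla z i j k x -
  3%:R^-1 * (\sum_l cchristoffel nabla z l l j x * (i == k)%:R +
             \sum_l cchristoffel nabla z l l k x * (i == j)%:R).

Definition Pi2 (nabla : connection M) z (i j : 'I_2) x : C :=
  \sum_k \sum_l Pi3 nabla z k i l x * Pi3 nabla z l j k x -
  \sum_k Dz k (Pi3 nabla z k i j) x.

End Connections.

Section CartanGeometry.
Context {R : realType}.
Local Notation C := R[i].

(* The indices 1, 2 among 0, 1, 2. *)
Definition up (i : 'I_2) : 'I_3 := lift ord0 i.

(* The preimage in SL(3,C) of the stabiliser P of [1,0,0]^t in PSL(3,C).  An
   action of P is an action of [parabolic] in which scalar matrices (the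
   centre of SL(3,C)) act trivially. *)
Definition parabolic : set 'M[C]_3 :=
  [set p | \det p = 1 /\ forall i, p (up i) ord0 = 0].

(* [pb_act_smooth] says that B x P -> B is smooth: it is tested on smooth maps
   from open sets of R^k.  [pb_trivial]: over small open sets U there are a
   smooth section s and a diffeomorphism from U x P onto the preimage of U,
   (y, p) |-> s(y) p; the P-component of its inverse lifts locally to a smooth
   map q into the finite covering [parabolic] of P. *)
Record principal_bundle (M : complex_surface R) := PrincipalBundle {
  pb_total :> manifold R 16;
  pb_proj : pb_total -> M;
  pb_act : pb_total -> 'M[C]_3 -> pb_total;
  pb_proj_smooth : smooth_map setT pb_proj;
  pb_act1 : forall b, pb_act b 1%:M = b;
  pb_actM : forall b p q, parabolic p -> parabolic q ->
    pb_act (pb_act b p) q = pb_act b (p *m q);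
  pb_fibre : forall b b', pb_proj b = pb_proj b' <->
    exists2 p, parabolic p & b' = pb_act b p;
  pb_free : forall b p, parabolic p -> pb_act b p = b <-> is_scalar_mx p;
  pb_act_smooth : forall k (O : set 'rV[R]_k) (beta : 'rV[R]_k -> pb_total)
      (c : 'rV[R]_k -> 'M[C]_3), open O ->
    smooth_into O beta -> smooth_cmx O c -> (forall t, O t -> parabolic (c t)) ->
    smooth_into O (fun t => pb_act (beta t) (c t));
  pb_trivial : forall x : M, exists (U : set M) (s : M -> pb_total),
    [/\ open U, U x, smooth_map U s, forall y, U y -> pb_proj (s y) = y
      & forall b, U (pb_proj b) -> exists (V : set pb_total) (q : pb_total -> 'M[C]_3),
        [/\ open V, V b, smooth_cmx_fun V q
          & forall b', V b' -> [/\ U (pb_proj b'), parabolic (q b')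
                                 & b' = pb_act (s (pb_proj b')) (q b')]]] }.

(* A matrix-valued 1-form on B: chart, point and tangent vector in the chart. *)
Definition mxform (M : complex_surface R) (B : principal_bundle M) :=
  chart R 16 B -> 'rV[R]_16 -> 'rV[R]_16 -> 'M[C]_3.

Variables (M : complex_surface R) (B : principal_bundle M).

(* In [cartan_fundamental], the velocity of b c(t) at t = 0 is the value at b of
   the fundamental vector field of c'(0), an arbitrary element of Lie(P). *)
Record cartan_connection (theta : mxform B) : Prop := CartanConnection {
  cartan_linear : forall phi x a u v, atlas phi -> chart_image phi x ->
    theta phi x (a *: u + v) = (a%:C)%C *: theta phi x u + theta phi x v;
  cartan_smooth : forall phi u, atlas phi ->
    smooth_cmx (chart_image phi) (fun x => theta phi x u);
  cartan_trans : forall phi psi x u, atlas phi -> atlas psi ->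
    overlap phi psi x ->
    theta psi (transition phi psi x) ('D_u (transition phi psi) x) = theta phi x u;
  cartan_trace : forall phi x u, atlas phi -> chart_image phi x ->
    \tr (theta phi x u) = 0;
  cartan_iso : forall phi x X, atlas phi -> chart_image phi x -> \tr X = 0 ->
    exists! u, theta phi x u = X;
  cartan_equivariant : forall p (b : B) phi psi u, parabolic p ->
    atlas phi -> atlas psi -> chart_dom phi b -> chart_dom psi (pb_act b p) ->
    theta psi (fwd psi (pb_act b p))
      ('D_u (fun x => fwd psi (pb_act (bwd phi x) p)) (fwd phi b)) =
    invmx p *m theta phi (fwd phi b) u *m p;
  cartan_fundamental : forall (c : R -> 'M[C]_3) (b : B) phi,
    smooth_cmx setT c -> (forall t, parabolic (c t)) -> c 0 = 1%:M ->
    atlas phi -> chart_dom phi b ->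
    theta phi (fwd phi b) ('D_1 (fun t => fwd phi (pb_act b (c t))) 0) =
    Dcmx (1 : R) c 0 }.

(* The form [A u] is the pull-back by s of theta, read in the coordinates z. *)
Definition adapted_section (theta : mxform B) (nabla : connection M)
    (z : chart R (2 + 2) M) (s : M -> B) : Prop :=
  [/\ smooth_map (chart_dom z) s, forall y, chart_dom z y -> pb_proj (s y) = y
    & forall x psi, chart_image z x -> atlas psi -> chart_dom psi (s (bwd z x)) ->
      let A u := theta psi (fwd psi (s (bwd z x)))
                   ('D_u (fwd psi \o s \o bwd z) x) in
      forall u,
      [/\ A u ord0 ord0 = 0,
          forall i, A u (up i) ord0 = dz i u,
          forall i j, A u (up i) (up j) = \sum_k Pi3 nabla z i j k x * dz k u
        & forall i, A u ord0 (up i) = \sum_k Pi2 nabla z i k x * dz k u]].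

(* Pi3 and Pi2 do not depend on the representative nabla of S. *)
Definition cartan_geometry_of (S : set (connection M)) (theta : mxform B) :
    Prop :=
  cartan_connection theta /\
  forall nabla z, S nabla -> atlas z ->
    exists s, adapted_section theta nabla z s /\
      forall s', adapted_section theta nabla z s' ->
        forall y, chart_dom z y -> s' y = s y.

(* d theta + theta /\ theta, with the convention
   (alpha /\ beta)(u, v) = alpha(u) beta(v) - alpha(v) beta(u). *)
Definition curvature (theta : mxform B) phi x u v : 'M[C]_3 :=
  Dcmx u (fun y => theta phi y v) x - Dcmx v (fun y => theta phi y u) x +
  (theta phi x u *m theta phi x v - theta phi x v *m theta phi x u).

Definition wedge2 (T : Type) (alpha beta : T -> C) (u v : T) : C :=
  alpha u * beta v - alpha v * beta u.

(* Index order: [W b i k l j] is W^i_{k l jbar} at b, [K b i l j] is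
   K_{i l jbar} at b. *)
Record curvature_functions (theta : mxform B) (L : B -> 'I_2 -> C)
    (K : B -> 'I_2 -> 'I_2 -> 'I_2 -> C)
    (W : B -> 'I_2 -> 'I_2 -> 'I_2 -> 'I_2 -> C) : Prop :=
  CurvatureFunctions {
  curv_eq : forall b phi u v, atlas phi -> chart_dom phi b ->
    let Th := curvature theta phi (fwd phi b) u v in
    let th (i : 'I_2) u' := theta phi (fwd phi b) u' (up i) ord0 in
    let thbar (i : 'I_2) u' := conjc (th i u') in
    [/\ Th ord0 ord0 = 0,
        forall i, Th (up i) ord0 = 0,
        forall i, Th ord0 (up i) =
          L b i * wedge2 (th 0) (th 1) u v +
          \sum_l \sum_j K b i l j * wedge2 (th l) (thbar j) u v
      & forall i k, Th (up i) (up k) =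
          \sum_l \sum_j W b i k l j * wedge2 (th l) (thbar j) u v];
  curv_trace : forall b i j, \sum_l W b l l i j = 0;
  curv_sym : forall b i k l j, W b i k l j = W b i l k j }.

End CartanGeometry.

(* Main.v *)
(** A Kaehler metric g with Levi-Civita connection in the class is pulled back to B:
    in the coframe theta^i_0 it has components h_(i jbar).  The linear system is
    pointwise and real-homogeneous, so no density weight is needed.  In a holomorphic
    chart the LC equation reads d_k h_(i jbar) = Gamma^s_(ki) h_(s jbar), hence
    h_(s jbar) d_lbar Gamma^s_(ki) = d_lbar d_k h_(i jbar)
      - Gamma^s_(ki) conj(Gamma^t_(lj)) h_(s tbar),
    which is hermitian and symmetric in (k, i) and in (l, j).  Its trace is then hermitian
    too, and W^s_(ik lbar) = - d_lbar Pi^s_(ik), its trace-free part, satisfies the system.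

    A point b of B is sigma_z(y) p with p in the parabolic subgroup, and the section
    sigma_z p pulls theta back to p^-1 (sigma_z^* theta) p.  Pulling back the structure
    equation and evaluating on (d_r, d_tbar), where (2,0)-forms vanish, identifies W at b
    with the chart tensor in the frame [frame p].  That h transforms by the same frame
    amounts to: theta^i_0 (u) = 0 implies that u is vertical, because such u are
    velocities of curves b c(t) with c in the parabolic subgroup. *)

Require Import Defs.
From HB Require Import structures.
From mathcomp Require Import all_boot all_order all_algebra.
From mathcomp Require Import complex.
From mathcomp Require Import all_classical all_reals all_analysis.
From mathcomp Require Import ring lra.

Set Implicit Arguments.
Unset Strict Implicit.
Unset Printing Implicit Defensive.

Import Order.TTheory GRing.Theory Num.Theory.
Import numFieldNormedType.Exports.

Local Open Scope classical_set_scope.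
Local Open Scope ring_scope.

(** * Calculus in finite dimension *)

(** Smoothness is phrased through iterated directional derivatives only, so linearity in the
    direction, symmetry of second derivatives and the chain rule are derived from the one-variable
    mean value theorem.

    Nondegeneracy of g serves twice: for the nonvanishing determinant, and for the trace, which is
    hermitian because it contracts the lowered curvature with the inverse of the hermitian matrix.

    The frame depends on a chart, a section and a group element, none of them preferred. Hence h is
    characterised by the choice-free identity pi^* g = h_(i jbar) theta^i_0 conj(theta^j_0). The
    algebra at a point may then use any chart, while smoothness of h is read off from the identity
    itself.

    The axiom on fundamental fields speaks of curves that lie in the parabolic group for all real t.
    Explicit unipotent and diagonal curves are used, whose velocities span Lie(P); the diagonal ones
    must avoid the value 0 on the whole line. *)

Section SmoothFunctions.
Context {R : realType} {V : normedModType R}.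
Implicit Types (U : set V) (f g : V -> R).

Lemma ckS k U f : ck k.+1 U f -> ck k U f.
Proof.
elim: k f => [|k IH] f; first by case.
by case=> cf df; split=> // v; have [? ?] := df v; split=> //; exact: IH.
Qed.

Lemma ck_sub k U U' f : U' `<=` U -> ck k U f -> ck k U' f.
Proof.
move=> sU; elim: k f => [|k IH] f [cf df]; split=> //; do ?by move=> x /sU /cf.
move=> v; have [h1 h2] := df v; split; first by move=> x /sU /h1.
exact: IH.
Qed.

(** The sets [U'] need not be open: continuity and derivability at a point refer to the whole space
    [V], so [ck] is a condition on the points of [U] one by one. *)
Lemma ck_local k U f :
  (forall x, U x -> exists U', U' x /\ ck k U' f) -> ck k U f.
Proof.
elim: k f => [|k IH] f H; split=> //; do ?by
  move=> x /H [U' [U'x [cf _]]]; exact: cf.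
move=> v; split; first by move=> x /H [U' [U'x [_ /(_ v) [h _]]]]; exact: h.
apply: IH => x /H [U' [U'x [_ /(_ v) [_ h]]]]; by exists U'.
Qed.

Lemma near_eq_open (T : Type) U (f g : V -> T) x : open U -> {in U, f =1 g} -> U x ->
  {near x, f =1 g}.
Proof.
move=> oU fg Ux; have : nbhs x U by exact: open_nbhs_nbhs.
by apply: filterS => y Uy; apply: fg; rewrite inE.
Qed.

Lemma continuous_eq_open U f g x : open U -> {in U, f =1 g} -> U x ->
  {for x, continuous f} -> {for x, continuous g}.
Proof.
move=> oU fg Ux; change (f @ x --> f x -> g @ x --> g x).
rewrite (fg x) ?inE//; apply: cvg_trans.
by apply: near_eq_cvg; apply: near_eq_open Ux => // y /fg.
Qed.

Lemma ck_eq k U f g : open U -> {in U, f =1 g} -> ck k U f -> ck k U g.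
Proof.
move=> oU; elim: k f g => [|k IH] f g fg [cf df].
  by split=> // x Ux; exact: (continuous_eq_open oU fg Ux (cf x Ux)).
split=> [x Ux|]; first exact: (continuous_eq_open oU fg Ux (cf x Ux)).
- move=> v; have [h1 h2] := df v; split.
    move=> x Ux; apply: near_eq_derivable (h1 x Ux).
    exact: near_eq_open Ux.
  apply: IH h2 => x; rewrite inE => Ux.
  by apply: near_eq_derive; exact: near_eq_open Ux.
Qed.

Lemma ck_cst k U (a : R) : ck k U (fun=> a).
Proof.
elim: k a => [|k IH] a; split=> //; do ?by move=> x _; exact: cst_continuous.
move=> v; split; first by move=> x _; exact: derivable_cst.
suff -> : 'D_v (fun=> a) = (fun=> 0 : R) by exact: IH.
by apply/funext => x; exact: derive_cst.
Qed.

Lemma ckD k U f g : open U -> ck k U f -> ck k U g -> ck k U (f + g).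
Proof.
move=> oU; elim: k f g => [|k IH] f g [cf df] [cg dg]; split=> //; do ?by
  move=> x Ux; apply: continuousD; [exact: cf|exact: cg].
move=> v; have [f1 f2] := df v; have [g1 g2] := dg v; split.
  by move=> x Ux; apply: derivableD; [exact: f1|exact: g1].
apply: ck_eq (IH _ _ f2 g2) => // x; rewrite inE => Ux /=.
by rewrite deriveD//; [exact: f1|exact: g1].
Qed.

Lemma ckM k U f g : open U -> ck k U f -> ck k U g -> ck k U (f * g).
Proof.
move=> oU; elim: k f g => [|k IH] f g Hf Hg.
  case: Hf Hg => cf df [cg dg]; split=> //.
  by move=> x Ux; apply: continuousM; [exact: cf|exact: cg].
have cf := ckS Hf; have cg := ckS Hg; split.
  case: Hf Hg => Cf _ [Cg _].
  by move=> x Ux; apply: continuousM; [exact: Cf|exact: Cg].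
case: Hf Hg => _ df [_ dg].
move=> v; have [f1 f2] := df v; have [g1 g2] := dg v; split.
  by move=> x Ux; apply: derivableM; [exact: f1|exact: g1].
apply: ck_eq (ckD oU (IH _ _ cf g2) (IH _ _ cg f2)) => // x; rewrite inE => Ux.
by rewrite deriveM//; [exact: f1|exact: g1].
Qed.

Lemma ckV k U f : open U -> (forall x, U x -> f x != 0) -> ck k U f ->
  ck k U (fun x => (f x)^-1).
Proof.
move=> oU f0; elim: k => [|k IH] Hf.
  case: Hf => cf df; split=> //.
  by move=> x Ux; apply: cvgV; [exact: f0|exact: cf].
have IHf := IH (ckS Hf); case: Hf => cf df; split.
  by move=> x Ux; apply: cvgV; [exact: f0|exact: cf].
move=> v; have [f1 f2] := df v; split.
  by move=> x Ux; apply: derivableV; [exact: f0|exact: f1].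
(* The derivative is - f^-2 D_v f, a product of functions already known to be of class C^k. *)
apply: ck_eq (ckM oU (ck_cst k U (-1)) (ckM oU (ckM oU IHf IHf) f2)) => //.
move=> x; rewrite inE => Ux; rewrite deriveV; [|exact: f0|exact: f1].
by rewrite !fctE /= /GRing.scale/= mulN1r mulNr -expr2 exprVn.
Qed.

Lemma smooth_derivable U f x v : smooth_on U f -> U x -> derivable f x v.
Proof. by move=> /(_ 1%N) [_ /(_ v) [h _]] /h. Qed.

Lemma smooth_continuous U f x : smooth_on U f -> U x -> {for x, continuous f}.
Proof. by move=> /(_ 0%N) [h _] /h. Qed.

Lemma smooth_derive U f v : smooth_on U f -> smooth_on U ('D_v f).
Proof. by move=> sf k; have [_ /(_ v) []] := sf k.+1. Qed.

Lemma smooth_sub U U' f : U' `<=` U -> smooth_on U f -> smooth_on U' f.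
Proof. by move=> sU sf k; exact: ck_sub (sf k). Qed.

Lemma smooth_eq U f g : open U -> {in U, f =1 g} ->
  smooth_on U f -> smooth_on U g.
Proof. by move=> oU fg sf k; exact: ck_eq (sf k). Qed.

Lemma smooth_local U f :
  (forall x, U x -> exists U', U' x /\ smooth_on U' f) -> smooth_on U f.
Proof.
by move=> H k; apply: ck_local => x /H [U' [? ?]]; exists U'; split.
Qed.

Lemma smooth_cst U (a : R) : smooth_on U (fun=> a).
Proof. by move=> k; exact: ck_cst. Qed.

Lemma smoothD U f g : open U -> smooth_on U f -> smooth_on U g ->
  smooth_on U (fun x => f x + g x).
Proof. by move=> oU sf sg k; exact: ckD. Qed.

Lemma smoothM U f g : open U -> smooth_on U f -> smooth_on U g ->
  smooth_on U (fun x => f x * g x).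
Proof. by move=> oU sf sg k; exact: ckM. Qed.

Lemma smoothN U f : open U -> smooth_on U f -> smooth_on U (fun x => - f x).
Proof.
move=> oU sf; have := smoothM oU (smooth_cst U (-1)) sf.
by apply: smooth_eq => // x _; rewrite mulN1r.
Qed.

Lemma smoothV U f : open U -> (forall x, U x -> f x != 0) -> smooth_on U f ->
  smooth_on U (fun x => (f x)^-1).
Proof. by move=> oU f0 sf k; exact: ckV. Qed.

Lemma smooth_sum U (I : Type) (r : seq I) (P : pred I) (f : I -> V -> R) :
  open U -> (forall i, P i -> smooth_on U (f i)) ->
  smooth_on U (fun x => \sum_(i <- r | P i) f i x).
Proof.
move=> oU sf; elim: r => [|i r IH].
  by apply: smooth_eq (smooth_cst U 0) => // x _; rewrite big_nil.
case Pi: (P i).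
  by apply: smooth_eq (smoothD oU (sf i Pi) IH) => // x _; rewrite big_cons Pi.
by apply: smooth_eq IH => // x _; rewrite big_cons Pi.
Qed.

(** Only derivability along [v] is available, so the claim is reduced to the function t -> f(t v +
    x) and the one-variable chain rule with t -> a t. The case a = 0 is included. *)
Lemma deriveZv f x (a : R) v : derivable f x v ->
  derivable f x (a *: v) /\ 'D_(a *: v) f x = a * 'D_v f x.
Proof.
move=> dfv; have /derivable1P dh := dfv.
have sE : (fun h : R => f (h *: (a *: v) + x)) =
          (fun h : R => f (h *: v + x)) \o (fun h => a * h).
  by apply/funext => h /=; rewrite scalerA mulrC.
have daE : is_derive (0 : R) 1 (fun h : R => a * h) a.
    have -> : (fun h : R => a * h) = cst a * id by [].
    by apply: is_derive_eq; rewrite scaler0 addr0 /GRing.scale/= mulr1.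
have da : differentiable (fun h : R => a * h) 0.
  by apply/derivable1_diffP; exact: ex_derive.
have dh' : differentiable (fun h : R => f (h *: v + x)) (a * 0).
  by rewrite mulr0; exact/derivable1_diffP.
have dc : derivable (fun h : R => f (h *: (a *: v) + x)) 0 1.
  by rewrite sE; apply/derivable1_diffP/differentiable_comp.
split; first exact/derivable1P.
have DE (w : V) : 'D_w f x = 'D_1 (fun h : R => f (h *: w + x)) 0.
  rewrite /derive; set g1 := fun h => h^-1 *: _; set g2 := fun h => h^-1 *: _.
  suff -> : g1 = g2 by []; apply/funext => h; rewrite /g1 /g2 /=.
  by rewrite addr0 scale0r add0r [_%:A]mulr1.
rewrite !DE sE deriveE; last exact: differentiable_comp.
rewrite diff_comp//= mulr0.
have -> : 'd (fun h : R => a * h) 0 1 = a.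
  by rewrite -deriveE// derive_val.
rewrite -[X in 'd _ _ X]mulr1 [LHS]linearZ/= -deriveE//.
by move: dh'; rewrite mulr0.
Qed.

End SmoothFunctions.

(** * Mean value arguments: additivity in the direction and symmetry of second derivatives *)

Section MeanValue.
Context {R : realType} {V : normedModType R}.
Implicit Types (U : set V) (f g : V -> R).

Lemma derive_lineE f (x v : V) (c : R) :
  derivable f (c *: v + x) v ->
  is_derive c 1 (fun h : R => f (h *: v + x)) ('D_v f (c *: v + x)).
Proof.
have E : (fun h : R => h^-1 *: (((fun h : R => f (h *: v + x)) \o shift c) (h *: 1)
             - f (c *: v + x))) =
         (fun h : R => h^-1 *: ((f \o shift (c *: v + x)) (h *: v) - f (c *: v + x))).
  by apply/funext => h /=; rewrite [h%:A]mulr1 scalerDl addrA.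
by move=> df; apply: DeriveDef; rewrite ?/derivable ?/derive E.
Qed.

Lemma derive_shiftE f (x y v : V) :
  'D_v (fun z => f (y + z)) x = 'D_v f (y + x) /\
  (derivable f (y + x) v -> derivable (fun z => f (y + z)) x v).
Proof.
have E : (fun h : R => h^-1 *: (((fun z => f (y + z)) \o shift x) (h *: v) - f (y + x))) =
         (fun h : R => h^-1 *: ((f \o shift (y + x)) (h *: v) - f (y + x))).
  by apply/funext => h /=; rewrite addrCA.
by rewrite /derivable /derive E.
Qed.

Lemma mvt_line f (x v : V) :
  (forall c : R, 0 <= c <= 1 -> derivable f (c *: v + x) v) ->
  exists2 c : R, 0 <= c <= 1 & f (v + x) - f x = 'D_v f (c *: v + x).
Proof.
move=> df; pose g h := f (h *: v + x).
have dg (c : R) : 0 <= c <= 1 -> is_derive c 1 g ('D_v f (c *: v + x)).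
  by move=> c01; apply: derive_lineE; exact: df.
have [||c c01] := @MVT_segment R g (fun c => 'D_v f (c *: v + x)) 0 1 ler01.
- by move=> c; rewrite in_itv/= => /andP[c0 c1]; apply: dg; rewrite !ltW.
- apply: derivable_within_continuous => c; rewrite in_itv/= => c01.
  by have /@ex_derive := dg c c01.
rewrite /g scale1r scale0r add0r subr0 mulr1 => ->; exists c => //.
Qed.

Lemma mvt_scale f (x v : V) (h : R) :
  (forall c : R, 0 <= c <= 1 -> derivable f ((c * h) *: v + x) v) ->
  exists2 c : R, 0 <= c <= 1 & f (h *: v + x) - f x = h * 'D_v f ((c * h) *: v + x).
Proof.
move=> df; have [c c01|c c01 ->] := @mvt_line f x (h *: v).
  by rewrite scalerA; have [] := deriveZv h (df c c01).
exists c => //; rewrite scalerA.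
by have [] := deriveZv h (df c c01).
Qed.

(** The intermediate points of the mean value arguments lie in a parallelogram at [x] whose size is
    linear in [h]; for small [h] it stays in the given neighbourhood. *)
Lemma near_span (x u v : V) (P : set V) : nbhs x P ->
  \forall h \near (0 : R), forall c d : R, `|c| <= 1 -> `|d| <= 1 ->
    P ((c * h) *: u + ((d * h) *: v + x)).
Proof.
move=> /nbhs_ballP [e /= e0 eP].
(* The summand 1 keeps the bound positive when u = v = 0. *)
have K0 : 0 < `|u| + `|v| + 1 by rewrite ltr_wpDl// addr_ge0.
near=> h => c d c1 d1; apply: eP.
rewrite -ball_normE /= addrA opprD addrCA subrr addr0 normrN.
have hK : `|h| * (`|u| + `|v| + 1) < e.
  by rewrite -ltr_pdivlMr//; near: h; apply: (@nbhs0_lt _ R); rewrite divr_gt0.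
apply: le_lt_trans hK; rewrite (le_trans (ler_normD _ _))// !normrZ.
rewrite mulrDr mulr1 mulrDr -[leLHS]addr0 !lerD//.
- by rewrite -mulrA ler_piMl// mulr_ge0.
- by rewrite -mulrA ler_piMl// mulr_ge0.
Unshelve. all: by end_near. Qed.

Lemma norm01 (c : R) : 0 <= c <= 1 -> `|c| <= 1.
Proof. by move=> /andP[c0 c1]; rewrite ger0_norm. Qed.

(** The increment along u + v is a step along [u] followed by a step along [v]. The quotient of the
    second step is D_v f at an intermediate point, and it tends to D_v f x because D_v f is
    continuous. *)
Lemma deriveDv U f x u v : open U -> U x -> ck 1 U f ->
  'D_(u + v) f x = 'D_u f x + 'D_v f x.
Proof.
move=> oU Ux [_ df]; have [du [cu _]] := df u; have [dv [cv _]] := df v.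
have nU : nbhs x U by exact: open_nbhs_nbhs.
have := near_span u v nU => /nbhs_dnbhs nUh.
apply: cvg_lim => //; apply/cvgrPdist_le => /= e e0.
have e2 : 0 < e / 2 by rewrite divr_gt0.
have cvx : \forall t \near x, `|'D_v f x - 'D_v f t| <= e / 2.
  exact: (cvgrPdist_le _ _).1 (cv x Ux) _ e2.
have := near_span u v cvx => /nbhs_dnbhs nv.
have nu : \forall h \near (0 : R)^',
    `|'D_u f x - h^-1 *: (f (h *: u + x) - f x)| <= e / 2.
  exact: (cvgrPdist_le _ _).1 (du x Ux) _ e2.
near=> h.
have h0 : h != 0 by near: h; exact: nbhs_dnbhs_neq.
have [|c c01 E] := @mvt_scale f (h *: u + x) v h.
  move=> c c01; apply: dv.
  have -> : (c * h) *: v + (h *: u + x) = (1 * h) *: u + ((c * h) *: v + x).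
    by rewrite mul1r addrCA.
  move: c c01; near: h; move: nUh; apply: filterS => h H c /norm01 c01.
  by apply: H => //; rewrite normr1.
have -> : h^-1 *: (f (h *: (u + v) + x) - f x) =
   'D_v f ((c * h) *: v + (h *: u + x)) + h^-1 *: (f (h *: u + x) - f x).
  have -> : h *: (u + v) + x = h *: v + (h *: u + x).
    by rewrite scalerDr addrCA addrA.
  rewrite -(subrK (f (h *: u + x)) (f (h *: v + _))) E -addrA scalerDr.
  by rewrite {1}/GRing.scale/= mulKf.
rewrite [X in `|X - _|]addrC opprD addrACA (splitr e).
rewrite (le_trans (ler_normD _ _))// lerD//; last by near: h; exact: nu.
have -> : (c * h) *: v + (h *: u + x) = (1 * h) *: u + ((c * h) *: v + x).
  by rewrite mul1r addrCA.
move: c c01 {E}; near: h; move: nv; apply: filterS => h H c /norm01 c01.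
by apply: H => //; rewrite normr1.
Unshelve. all: by end_near. Qed.

(** The mean value theorem is applied to the increment y -> f(h v + y) - f(y) along [u], then to D_u
    f along [v]. *)
Lemma second_difference U f x u v (h : R) : ck 2 U f ->
  (forall c d : R, 0 <= c <= 1 -> 0 <= d <= 1 ->
     U ((c * h) *: v + ((d * h) *: u + x))) ->
  exists c d : R, [/\ 0 <= c <= 1, 0 <= d <= 1 &
    f (h *: v + (h *: u + x)) - f (h *: u + x) - (f (h *: v + x) - f x) =
    h * (h * 'D_v ('D_u f) ((c * h) *: v + ((d * h) *: u + x)))].
Proof.
move=> [_ df] HU; have [du [_ ddu]] := df u; have [dvu _] := ddu v.
have i0 : 0 <= (0 : R) <= 1 by rewrite lexx ler01.
have i1 : 0 <= (1 : R) <= 1 by rewrite lexx ler01.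
pose F := (fun y => f (h *: v + y)) - f.
have dF (d : R) : 0 <= d <= 1 -> is_derive ((d * h) *: u + x) u F
   ('D_u f (h *: v + ((d * h) *: u + x)) - 'D_u f ((d * h) *: u + x)).
  move=> d01; have [D1 D2] := derive_shiftE f ((d * h) *: u + x) (h *: v) u.
  have D3 : derivable f (h *: v + ((d * h) *: u + x)) u.
    by apply: du; have := HU 1 d i1 d01; rewrite mul1r.
  have D4 : derivable f ((d * h) *: u + x) u.
    by apply: du; have := HU 0 d i0 d01; rewrite mul0r scale0r add0r.
  apply: is_deriveB; last exact: derivableP.
  by apply: DeriveDef; [exact: D2|].
have [|d d01] := @mvt_scale F x u h.
  by move=> d d01; exact: (@ex_derive _ _ _ _ _ _ _ (dF d d01)).
rewrite (@derive_val _ _ _ _ _ _ _ (dF d d01)).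
have [|c c01 ->] := @mvt_scale ('D_u f) ((d * h) *: u + x) v h.
  by move=> c c01; apply: dvu; exact: HU.
by move=> E; exists c, d; split.
Qed.

Lemma near0_ex (P Q : set R) : nbhs (0 : R) P -> nbhs (0 : R) Q ->
  exists h : R, [/\ h != 0, P h & Q h].
Proof.
move=> nP nQ; apply: (@filter_ex _ (0 : R)^'); near=> h.
by split; near: h; [exact: nbhs_dnbhs_neq|exact: nbhs_dnbhs..].
Unshelve. all: by end_near. Qed.

(** The second difference is symmetric in [u] and [v]; after division by h^2 it is a value of either
    mixed derivative at a point near [x]. Continuity at [x] then bounds the difference of the two by
    any [e], and one nonzero [h] is enough for each [e]. *)
Lemma derive_comm U f x u v : open U -> U x -> ck 2 U f ->
  'D_u ('D_v f) x = 'D_v ('D_u f) x.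
Proof.
move=> oU Ux sf; have nU : nbhs x U by exact: open_nbhs_nbhs.
have [_ df] := sf; have [_ [_ ddu]] := df u; have [_ [_ ddv]] := df v.
have [_ [cuv _]] := ddu v; have [_ [cvu _]] := ddv u.
apply/eqP; rewrite -subr_eq0 -normr_le0; apply/ler_addgt0Pl => e e0.
rewrite addr0.
have e2 : 0 < e / 2 by rewrite divr_gt0.
have nuv : \forall t \near x, `|'D_v ('D_u f) x - 'D_v ('D_u f) t| <= e / 2.
  exact: (cvgrPdist_le _ _).1 (cuv x Ux) _ e2.
have nvu : \forall t \near x, `|'D_u ('D_v f) x - 'D_u ('D_v f) t| <= e / 2.
  exact: (cvgrPdist_le _ _).1 (cvu x Ux) _ e2.
have NI (P Q : set V) : nbhs x P -> nbhs x Q -> nbhs x (P `&` Q) by exact: filterI.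
have nUuv := near_span v u (NI _ _ nU nuv).
have nUvu := near_span u v (NI _ _ nU nvu).
have [h [h0 Huv Hvu]] := near0_ex nUuv nUvu.
have [|c [d [c01 d01 E1]]] := @second_difference U f x u v h sf.
  by move=> c d /norm01 c01 /norm01 d01; have [] := Huv c d c01 d01.
have [|c' [d' [c01' d01' E2]]] := @second_difference U f x v u h sf.
  by move=> c' d' /norm01 c01' /norm01 d01'; have [] := Hvu c' d' c01' d01'.
have E3 : f (h *: v + (h *: u + x)) - f (h *: u + x) - (f (h *: v + x) - f x) =
          f (h *: u + (h *: v + x)) - f (h *: v + x) - (f (h *: u + x) - f x).
  rewrite [h *: v + (_ + _)]addrCA; ring.
have := E3; rewrite E1 E2 => /(mulfI h0) /(mulfI h0) E.
have [_ /=A] := Huv c d (norm01 c01) (norm01 d01).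
have [_ /=B] := Hvu c' d' (norm01 c01') (norm01 d01').
rewrite (splitr e) -(subrKA ('D_u ('D_v f) ((c' * h) *: u + ((d' * h) *: v + x)))).
apply: le_trans (ler_normD _ _) _; rewrite -[in X in _ + X]E [X in _ + X]distrC.
by apply: lerD; [exact: B|exact: A].
Qed.

End MeanValue.

(** * The chain rule and composition of smooth maps *)

Section ChainRule.
Context {R : realType} {n : nat}.
Implicit Types (U : set 'rV[R]_n) (g : 'rV[R]_n -> R).

Lemma derive_coordE U g y w : open U -> U y -> ck 1 U g ->
  'D_w g y = \sum_a w 0 a * 'D_(delta_mx 0 a) g y.
Proof.
move=> oU Uy sg; have [_ dg] := sg.
rewrite [w in LHS](row_sum_delta w).
elim: (index_enum _) => [|a r IH]; first by rewrite !big_nil derive0.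
rewrite !big_cons (deriveDv _ _ oU Uy sg) IH; congr (_ + _).
by have [_ ->] := deriveZv (w 0 a) ((dg (delta_mx 0 a)).1 y Uy).
Qed.

(** The increment [w h] of [f] is not a multiple of a fixed vector. The mean value theorem on the
    segment from f x to f x + w h gives D_(w h) g at an intermediate point; expanded in coordinates,
    h^-1 w h tends to D_v f x and the partial derivatives of [g] are continuous. *)
Lemma chain_rule_is (V : normedModType R) U g (f : V -> 'rV[R]_n) x v :
  open U -> U (f x) -> ck 1 U g -> derivable f x v ->
  is_derive x v (g \o f) ('D_('D_v f x) g (f x)).
Proof.
move=> oU Ux sg df; have [_ dg] := sg.
have nU : nbhs (f x) U by exact: open_nbhs_nbhs.
pose w (h : R) := f (h *: v + x) - f x.
have wc : w h @[h --> (0 : R)^'] --> (0 : 'rV[R]_n).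
  have : {for 0, continuous (fun h : R => f (h *: v + x))}.
    exact/differentiable_continuous/derivable1_diffP/(derivable1P _ _ _).1.
  move=> /continuous_withinNx; rewrite scale0r add0r => H.
  by rewrite -(subrr (f x)); apply: cvgB => //; exact: cvg_cst.
have mvt h : exists c : R, 0 <= c <= 1 /\
    ((forall d : R, 0 <= d <= 1 -> U (d *: w h + f x)) ->
      g (f (h *: v + x)) - g (f x) = 'D_(w h) g (c *: w h + f x)).
  case: (pselect (forall d : R, 0 <= d <= 1 -> U (d *: w h + f x))) => H; last first.
    (* A default value: for large [h] the segment may leave [U]. *)
    by exists 0; rewrite lexx ler01.
  have [|c c01 E] := @mvt_line _ _ g (f x) (w h).
    by move=> c /H Uc; exact: (dg (w h)).1.
  by exists c; split => // _; rewrite -E /w subrK.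
have [c cP] := choice mvt.
have pc : c h *: w h + f x @[h --> (0 : R)^'] --> f x.
  rewrite -[X in _ --> X]add0r; apply: cvgD; last exact: cvg_cst.
  apply/cvgr0Pnorm_lt => e e0; move/cvgr0Pnorm_lt: wc => /(_ e e0).
  apply: filterS => h; apply: le_lt_trans.
  by rewrite normrZ ler_piMl// norm01//; have [] := cP h.
pose Dg a := 'D_(delta_mx 0 a) g.
have key : (\sum_a (h^-1 *: w h) 0 a * Dg a (c h *: w h + f x)) @[h --> (0 : R)^']
    --> \sum_a ('D_v f x) 0 a * Dg a (f x).
  apply: cvg_big => [|a _]; first by move=> z; exact: add_continuous.
  apply: cvgM.
    apply: (@cvg_comp _ _ _ _ (fun M : 'rV[R]_n => M 0 a) _ _ _ df).
    exact: coord_continuous.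
  by apply: cvg_comp pc _; have [_ [+ _]] := dg (delta_mx 0 a); apply.
have lim : h^-1 *: ((g \o f) (h *: v + x) - (g \o f) x) @[h --> (0 : R)^']
    --> 'D_('D_v f x) g (f x).
  rewrite (derive_coordE _ oU Ux sg); apply: cvg_trans key.
  apply: near_eq_cvg.
  have segU : \forall h \near (0 : R)^', forall d : R, 0 <= d <= 1 -> U (d *: w h + f x).
    move/nbhs_ballP : nU => [e /= e0 eU].
    move/cvgr0Pnorm_lt: wc => /(_ e e0); apply: filterS => h whe d d01.
    apply: eU; rewrite -ball_normE /= opprD addrCA subrr addr0 normrN.
    by apply: le_lt_trans whe; rewrite normrZ ler_piMl// norm01.
  apply: filterS segU => h H /=; have [c01 /(_ H) ->] := cP h.
  have UU : U (c h *: w h + f x) by exact: H.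
  rewrite (derive_coordE _ oU UU sg) scaler_sumr; apply: eq_bigr => a _.
  by rewrite mxE /GRing.scale/= mulrA.
by apply: DeriveDef; [apply/cvg_ex; exists ('D_('D_v f x) g (f x))|exact: cvg_lim].
Qed.

End ChainRule.

Section SmoothComposition.
Context {R : realType} {V : normedModType R} {n : nat}.

Lemma mx_continuous (f : V -> 'rV[R]_n) x :
  (forall a, {for x, continuous (fun y => f y 0 a)}) -> {for x, continuous f}.
Proof.
move=> cf; apply/cvgrPdist_lt => e e0.
have H a : \forall y \near x, `|f x 0 a - f y 0 a| < e.
  exact: (cvgrPdist_lt _ _).1 (cf a) _ e0.
have nH : \forall y \near x, forall a, `|f x 0 a - f y 0 a| < e.
  by apply: filter_forall => a; exact: H.
move: nH; apply: filterS => y Hy.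
rewrite /Num.Def.normr/= mx_normrE.
apply: bigmax_lt => //= -[i a] _ /=; rewrite !mxE (ord1 i); exact: Hy.
Qed.

Lemma smooth_mx_derivable (U : set V) (f : V -> 'rV[R]_n) x v :
  smooth_mx U f -> U x -> derivable f x v.
Proof.
by move=> sf Ux; apply/derivable_mxP => i j; apply: smooth_derivable (sf i j) Ux.
Qed.

Lemma smooth_mx_deriveE (U : set V) (f : V -> 'rV[R]_n) x v a :
  smooth_mx U f -> U x -> ('D_v f x) 0 a = 'D_v (fun y => f y 0 a) x.
Proof.
by move=> sf Ux; rewrite derive_mx ?mxE//; exact: smooth_mx_derivable sf Ux.
Qed.

Lemma smooth_comp (U : set V) (U' : set 'rV[R]_n) (f : V -> 'rV[R]_n) g :
  open U -> open U' -> (forall x, U x -> U' (f x)) ->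
  smooth_mx U f -> smooth_on U' g -> smooth_on U (g \o f).
Proof.
(* [g] is generalised because the induction passes to its partial derivatives. *)
move=> oU oU' fU sf + k; move: g.
have cg g : smooth_on U' g -> forall x, U x -> {for x, continuous (g \o f)}.
  move=> sg x Ux; apply: continuous_comp; last exact: smooth_continuous sg (fU x Ux).
  by apply: mx_continuous => a; exact: smooth_continuous (sf 0 a) Ux.
elim: k => [|k IH] g sg; first by split=> //; exact: cg.
split; [exact: cg|move=> v].
have D x : U x -> is_derive x v (g \o f) ('D_('D_v f x) g (f x)).
  move=> Ux; apply: chain_rule_is oU' (fU x Ux) (sg 1%N) _.
  exact: smooth_mx_derivable sf Ux.
split; first by move=> x /D [].
have H a : ck k U ('D_v (fun y => f y 0 a) * ('D_(delta_mx 0 a) g \o f)).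
  by apply: ckM => //; [exact: smooth_derive (sf 0 a) k|apply: IH; exact: smooth_derive].
have S (r : seq 'I_n) :
    ck k U (\sum_(a <- r) ('D_v (fun y => f y 0 a) * ('D_(delta_mx 0 a) g \o f))).
  elim: r => [|a r IHr]; first by rewrite big_nil; exact: ck_cst.
  by rewrite big_cons; exact: ckD.
apply: ck_eq (S (index_enum _)) => // x; rewrite inE => Ux.
have [_ ->] := D x Ux; rewrite fct_sumE (derive_coordE _ oU' (fU x Ux) (sg 1%N)).
by apply: eq_bigr => a _; rewrite (smooth_mx_deriveE _ _ sf Ux).
Qed.

End SmoothComposition.

(** * Complex-valued functions of real variables *)

Section ComplexDerivatives.
Context {R : realType}.
Local Notation C := R[i].
Local Notation Re := (@complex.Re R).
Local Notation Im := (@complex.Im R).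
Local Notation ii := (Complex 0 1 : C).
Implicit Types z w : C.

Lemma ReD z w : Re (z + w) = Re z + Re w. Proof. by case: z w => [? ?] [? ?]. Qed.
Lemma ImD z w : Im (z + w) = Im z + Im w. Proof. by case: z w => [? ?] [? ?]. Qed.
Lemma ReN z : Re (- z) = - Re z. Proof. by case: z. Qed.
Lemma ImN z : Im (- z) = - Im z. Proof. by case: z. Qed.
Lemma ReM z w : Re (z * w) = Re z * Re w - Im z * Im w.
Proof. by case: z w => [? ?] [? ?]. Qed.
Lemma ImM z w : Im (z * w) = Re z * Im w + Im z * Re w.
Proof. by case: z w => [? ?] [? ?]. Qed.
Lemma Re_conjc z : Re (conjc z) = Re z. Proof. by case: z. Qed.
Lemma Im_conjc z : Im (conjc z) = - Im z. Proof. by case: z. Qed.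
Lemma complexP z w : Re z = Re w -> Im z = Im w -> z = w.
Proof. by case: z w => [? ?] [? ?] /= -> ->. Qed.
Lemma conjc_ii : conjc ii = - ii. Proof. by apply: complexP; rewrite /= ?oppr0. Qed.
Lemma iiM : ii * ii = -1. Proof. by apply: complexP; rewrite /= ?ReM ?ImM /= ; ring. Qed.

Lemma conjcM z w : conjc (z * w) = conjc z * conjc w. Proof. exact: rmorphM. Qed.
Lemma conjcD z w : conjc (z + w) = conjc z + conjc w. Proof. exact: rmorphD. Qed.
Lemma conjcN z : conjc (- z) = - conjc z. Proof. exact: rmorphN. Qed.
Lemma conjc_sum (I : Type) (r : seq I) (F : I -> C) :
  conjc (\sum_(i <- r) F i) = \sum_(i <- r) conjc (F i).
Proof. exact: rmorph_sum. Qed.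

Section Functions.
Context {V : normedModType R}.
Implicit Types (U : set V) (f g : V -> C) (x v : V).

Definition is_Dc x v f (l : C) :=
  is_derive x v (fun y => Re (f y)) (Re l) /\
  is_derive x v (fun y => Im (f y)) (Im l).

Lemma is_DcE x v f l : is_Dc x v f l -> Dc v f x = l.
Proof. by move=> [[_ dR] [_ dI]]; apply: complexP. Qed.

Lemma is_Dc_eq x v f l l' : is_Dc x v f l -> l = l' -> is_Dc x v f l'.
Proof. by move=> + <-. Qed.

Lemma is_Dc_near x v f g l : {near x, f =1 g} -> is_Dc x v f l -> is_Dc x v g l.
Proof.
move=> fg [dR dI]; split; [apply: near_eq_is_derive dR|apply: near_eq_is_derive dI];
  by apply: filterS fg => y ->.
Qed.

Lemma Dc_near x v f g : {near x, f =1 g} -> Dc v f x = Dc v g x.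
Proof.
by move=> fg; apply: complexP; apply: near_eq_derive; apply: filterS fg => y ->.
Qed.

Lemma is_Dc_cst x v z : is_Dc x v (fun=> z) 0.
Proof. by split; exact: is_derive_cst. Qed.

Lemma is_DcD x v f g a b : is_Dc x v f a -> is_Dc x v g b ->
  is_Dc x v (fun y => f y + g y) (a + b).
Proof.
move=> [fR fI] [gR gI]; split.
  rewrite ReD (_ : (fun y => _) = (fun y => Re (f y)) + (fun y => Re (g y))).
    exact: is_deriveD.
  by apply/funext => y; rewrite ReD.
rewrite ImD (_ : (fun y => _) = (fun y => Im (f y)) + (fun y => Im (g y))).
  exact: is_deriveD.
by apply/funext => y; rewrite ImD.
Qed.

Lemma is_DcM x v f g a b : is_Dc x v f a -> is_Dc x v g b ->
  is_Dc x v (fun y => f y * g y) (a * g x + f x * b).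
Proof.
move=> [fR fI] [gR gI]; split.
  rewrite (_ : (fun y => _) = (fun y => Re (f y)) * (fun y => Re (g y)) -
     (fun y => Im (f y)) * (fun y => Im (g y))).
    apply: is_derive_eq (is_deriveB (is_deriveM fR gR) (is_deriveM fI gI)) _.
    by rewrite !ReD !ReM /GRing.scale/=; ring.
  by apply/funext => y; rewrite ReM.
rewrite (_ : (fun y => _) = (fun y => Re (f y)) * (fun y => Im (g y)) +
     (fun y => Im (f y)) * (fun y => Re (g y))).
  apply: is_derive_eq (is_deriveD (is_deriveM fR gI) (is_deriveM fI gR)) _.
  by rewrite !ImD !ImM /GRing.scale/=; ring.
by apply/funext => y; rewrite ImM.
Qed.

Lemma is_DcMl x v z g b : is_Dc x v g b -> is_Dc x v (fun y => z * g y) (z * b).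
Proof.
move=> dg; apply: is_Dc_eq (is_DcM (is_Dc_cst x v z) dg) _; by rewrite mul0r add0r.
Qed.

Lemma is_DcMr x v z g b : is_Dc x v g b -> is_Dc x v (fun y => g y * z) (b * z).
Proof.
move=> dg; apply: is_Dc_eq (is_DcM dg (is_Dc_cst x v z)) _; by rewrite mulr0 addr0.
Qed.

Lemma is_Dc_sum x v (I : Type) (r : seq I) (f : I -> V -> C) (l : I -> C) :
  (forall i, is_Dc x v (f i) (l i)) ->
  is_Dc x v (fun y => \sum_(i <- r) f i y) (\sum_(i <- r) l i).
Proof.
move=> df; elim: r => [|i r IH].
  rewrite big_nil (_ : (fun y => _) = (fun=> 0)); first exact: is_Dc_cst.
  by apply/funext => y; rewrite big_nil.
rewrite big_cons (_ : (fun y => _) = (fun y => f i y + \sum_(j <- r) f j y)).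
  exact: is_DcD.
by apply/funext => y; rewrite big_cons.
Qed.

Lemma is_Dc_conj x v f l : is_Dc x v f l ->
  is_Dc x v (fun y => conjc (f y)) (conjc l).
Proof.
move=> [fR fI]; split.
  rewrite Re_conjc (_ : (fun y => _) = (fun y => Re (f y)))//.
  by apply/funext => y; rewrite Re_conjc.
rewrite Im_conjc (_ : (fun y => _) = - (fun y => Im (f y))); first exact: is_deriveN.
by apply/funext => y; rewrite Im_conjc.
Qed.

Definition csmooth U f :=
  smooth_on U (fun x => Re (f x)) /\ smooth_on U (fun x => Im (f x)).

Lemma csmooth_is_Dc U f x v : csmooth U f -> U x -> is_Dc x v f (Dc v f x).
Proof.
move=> [sR sI] Ux; split; apply: derivableP; first exact: smooth_derivable sR Ux.
exact: smooth_derivable sI Ux.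
Qed.

Lemma csmooth_Dc U f v : csmooth U f -> csmooth U (Dc v f).
Proof. by move=> [sR sI]; split; [exact: smooth_derive|exact: smooth_derive]. Qed.

Lemma csmooth_eq U f g : open U -> {in U, f =1 g} -> csmooth U f -> csmooth U g.
Proof.
by move=> oU fg [sR sI]; split; [apply: smooth_eq sR|apply: smooth_eq sI] => // x /fg ->.
Qed.

Lemma csmooth_sub U U' f : U' `<=` U -> csmooth U f -> csmooth U' f.
Proof. by move=> sU [? ?]; split; [apply: smooth_sub sU _|apply: smooth_sub sU _]. Qed.

Lemma csmooth_local U f :
  (forall x, U x -> exists U', U' x /\ csmooth U' f) -> csmooth U f.
Proof.
by move=> H; split; apply: smooth_local => x /H [U' [? []]]; exists U'.
Qed.

Lemma csmooth_cst U z : csmooth U (fun=> z).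
Proof. by split; exact: smooth_cst. Qed.

Lemma csmoothD U f g : open U -> csmooth U f -> csmooth U g ->
  csmooth U (fun x => f x + g x).
Proof.
move=> oU [fR fI] [gR gI]; split.
  by apply: smooth_eq (smoothD oU fR gR) => // x _; rewrite ReD.
by apply: smooth_eq (smoothD oU fI gI) => // x _; rewrite ImD.
Qed.

Lemma csmoothM U f g : open U -> csmooth U f -> csmooth U g ->
  csmooth U (fun x => f x * g x).
Proof.
move=> oU [fR fI] [gR gI]; split.
  apply: smooth_eq (smoothD oU (smoothM oU fR gR) (smoothN oU (smoothM oU fI gI))) => //.
  by move=> x _; rewrite ReM.
apply: smooth_eq (smoothD oU (smoothM oU fR gI) (smoothM oU fI gR)) => //.
by move=> x _; rewrite ImM.
Qed.

Lemma csmoothN U f : open U -> csmooth U f -> csmooth U (fun x => - f x).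
Proof.
move=> oU sf; apply: csmooth_eq (csmoothM oU (csmooth_cst U (-1)) sf) => // x _.
by rewrite mulN1r.
Qed.

Lemma csmooth_conj U f : open U -> csmooth U f -> csmooth U (fun x => conjc (f x)).
Proof.
move=> oU [fR fI]; split; first by apply: smooth_eq fR => // x _; rewrite Re_conjc.
by apply: smooth_eq (smoothN oU fI) => // x _; rewrite Im_conjc.
Qed.

Lemma csmooth_sum U (I : Type) (r : seq I) (f : I -> V -> C) : open U ->
  (forall i, csmooth U (f i)) -> csmooth U (fun x => \sum_(i <- r) f i x).
Proof.
move=> oU sf; elim: r => [|i r IH].
  by apply: csmooth_eq (csmooth_cst U 0) => // x _; rewrite big_nil.
by apply: csmooth_eq (csmoothD oU (sf i) IH) => // x _; rewrite big_cons.
Qed.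

Lemma csmooth_real U (f : V -> R) : smooth_on U f -> csmooth U (fun x => (f x)%:C%C).
Proof. by move=> sf; split => //=; exact: smooth_cst. Qed.

Lemma csmoothV U f : open U -> (forall x, U x -> f x != 0) -> csmooth U f ->
  csmooth U (fun x => (f x)^-1).
Proof.
move=> oU f0 [fR fI].
have n0 x : U x -> Re (f x) * Re (f x) + Im (f x) * Im (f x) != 0.
  move=> Ux; rewrite -!expr2; apply: contra (f0 x Ux).
  rewrite paddr_eq0 ?sqr_ge0// !sqrf_eq0 => /andP[/eqP a /eqP b].
  by apply/eqP; exact: complexP.
have sn := smoothV oU n0 (smoothD oU (smoothM oU fR fR) (smoothM oU fI fI)).
split.
  apply: smooth_eq (smoothM oU fR sn) => // x _.
  by case: (f x) => a b /=; rewrite !expr2.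
apply: smooth_eq (smoothM oU (smoothN oU fI) sn) => // x _.
by case: (f x) => a b /=; rewrite !expr2 mulNr.
Qed.

Lemma Dc_comm U f x u v : open U -> U x -> csmooth U f ->
  Dc u (Dc v f) x = Dc v (Dc u f) x.
Proof.
move=> oU Ux [sR sI]; apply: complexP => /=.
  exact: derive_comm oU Ux (sR 2%N).
exact: derive_comm oU Ux (sI 2%N).
Qed.

End Functions.

Section Chain.
Context {V : normedModType R} {n : nat}.

Lemma is_Dc_chain (U : set 'rV[R]_n) g (f : V -> 'rV[R]_n) x v :
  open U -> U (f x) -> csmooth U g -> derivable f x v ->
  is_Dc x v (g \o f) (Dc ('D_v f x) g (f x)).
Proof.
move=> oU Ux [sR sI] df; split.
  by have := chain_rule_is oU Ux (sR 1%N) df.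
by have := chain_rule_is oU Ux (sI 1%N) df.
Qed.

Lemma csmooth_comp (U : set V) (U' : set 'rV[R]_n) (f : V -> 'rV[R]_n) g :
  open U -> open U' -> (forall x, U x -> U' (f x)) ->
  smooth_mx U f -> csmooth U' g -> csmooth U (g \o f).
Proof.
move=> oU oU' fU sf [sR sI]; split; first exact: smooth_comp oU oU' fU sf sR.
exact: smooth_comp oU oU' fU sf sI.
Qed.

End Chain.
End ComplexDerivatives.

(** * Kaehler metrics in a holomorphic chart *)

Section ComplexCoordinates.
Context {R : realType}.
Local Notation C := R[i].
Local Notation ii := (Complex 0 1 : C).
Local Notation vect := 'rV[R]_(2 + 2).
Implicit Types (u v w : vect) (k l : 'I_2).

Definition ez (k : 'I_2) : vect := delta_mx 0 (lshift 2 k).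
Definition cvec (c : 'I_2 -> C) : vect :=
  row_mx (\row_k complex.Re (c k)) (\row_k complex.Im (c k)).

Lemma dz_cvec c k : dz k (cvec c) = c k.
Proof. by apply: complexP; rewrite /= ?row_mxEl ?row_mxEr mxE. Qed.

Lemma dz_inj u v : (forall k, dz k u = dz k v) -> u = v.
Proof.
move=> uv; apply/rowP => a; case: (split_ordP a) => k ->; have := uv k.
  by case.
by case.
Qed.

Lemma dz_lin (a : R) u v k : dz k (a *: u + v) = a%:C%C * dz k u + dz k v.
Proof. by apply: complexP; rewrite !(ReD, ReM, ImD, ImM) /= !mxE; ring. Qed.

Lemma dz_J u k : dz k (Jv u) = ii * dz k u.
Proof.
apply: complexP; rewrite !(ReM, ImM) /= /Jv ?row_mxEl ?row_mxEr !mxE; ring.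
Qed.

Lemma dz_ez k l : dz k (ez l) = (k == l)%:R.
Proof.
apply: complexP; rewrite /= /ez !mxE eqxx /= ?eq_lshift ?eq_rlshift.
  by case: eqP.
by case: eqP.
Qed.

Lemma JvK u : Jv (Jv u) = - u.
Proof.
apply: dz_inj => k; rewrite !dz_J mulrA iiM mulN1r.
by apply: complexP; rewrite !(ReN, ImN) /= !mxE.
Qed.

Lemma Jv_ez k : Jv (ez k) = delta_mx 0 (rshift 2 k).
Proof.
apply: dz_inj => l; rewrite dz_J dz_ez; apply: complexP;
  rewrite !(ReM, ImM) /= !mxE eqxx /= ?eq_lrshift ?eq_rshift; case: eqP => //= _; ring.
Qed.

Lemma dz_vec_sum k (F : 'I_(2 + 2) -> C) :
  \sum_a dz_vec k a * F a = (F (lshift 2 k) - ii * F (rshift 2 k)) / 2%:R.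
Proof.
rewrite big_split_ord /= (bigD1 k)//= [X in _ + X](bigD1 k)//= !big1 => [|l lk|l lk].
- by rewrite /dz_vec !eq_lshift !eq_rshift !eqxx eq_lrshift eq_rlshift /=; ring.
- by rewrite /dz_vec eq_rlshift eq_rshift (negPf lk) /= mulr0 subr0 mul0r mul0r.
- by rewrite /dz_vec eq_lrshift eq_lshift (negPf lk) /= mulr0 subr0 mul0r mul0r.
Qed.

Definition rlinear (F : vect -> C) :=
  forall (a : R) u v, F (a *: u + v) = a%:C%C * F u + F v.

Lemma rlinear_expand F u : rlinear F -> (forall v, F (Jv v) = ii * F v) ->
  F u = \sum_k dz k u * F (ez k).
Proof.
move=> lF JF.
have F0 : F 0 = 0.
  have := lF 1 0 0; rewrite scaler0 addr0 mul1r => /eqP.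
  by rewrite -subr_eq0 opprD addNKr oppr_eq0 => /eqP.
have FZ (a : R) v : F (a *: v) = a%:C%C * F v by rewrite -[a *: v]addr0 lF F0 addr0.
have FD v w : F (v + w) = F v + F w by rewrite -[v]scale1r lF scale1r mul1r.
have FS (r : seq 'I_2) (G : 'I_2 -> vect) : F (\sum_(k <- r) G k) = \sum_(k <- r) F (G k).
  by elim: r => [|k r IH]; rewrite ?big_nil// !big_cons FD IH.
have {1}-> : u = \sum_k (complex.Re (dz k u) *: ez k + complex.Im (dz k u) *: Jv (ez k)).
  apply/rowP => a; rewrite summxE; by case: (split_ordP a) => l ->;
    rewrite (bigD1 l)//= big1 => [|k kl]; rewrite Jv_ez !mxE eqxx /=
      ?eq_lshift ?eq_rshift ?eq_lrshift ?eq_rlshift ?eqxx /=;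
    rewrite ?[l == k]eq_sym ?(negPf kl) ?mulr0 ?mulr1 ?add0r ?addr0.
rewrite FS; apply: eq_bigr => k _; rewrite FD !FZ JF mulrA -mulrDl; congr (_ * _).
by case: (dz k u) => a b; apply: complexP; rewrite !(ReD, ReM, ImD, ImM) /=; ring.
Qed.

End ComplexCoordinates.

(** * The hermitian form of a J-invariant metric *)

Section Hermitian.
Context {R : realType}.
Local Notation C := R[i].
Local Notation ii := (Complex 0 1 : C).
Local Notation vect := 'rV[R]_(2 + 2).
Implicit Types (u v w : vect) (G : 'M[R]_(2 + 2)).

(** The form g(u, v) + i g(u, Jv); with this sign it is complex-linear in [u] and antilinear in [v]
    when g is symmetric and J-invariant. On [ez i], [ez j] it is then twice the complex-bilinear
    extension of g at (d_i, d_jbar). *)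
Definition hform G u v : C := Complex (bil G u v) (bil G u (Jv v)).

Lemma bilE G u v : bil G u v = \sum_b \sum_a u 0 a * G a b * v 0 b.
Proof.
by rewrite /bil mxE; apply: eq_bigr => b _; rewrite !mxE mulr_suml.
Qed.

Lemma bil_linl G (a : R) u w v : bil G (a *: u + w) v = a * bil G u v + bil G w v.
Proof. by rewrite /bil mulmxDl mulmxDl -!scalemxAl !mxE. Qed.

Lemma bilNl G u v : bil G (- u) v = - bil G u v.
Proof. by rewrite -[- u]addr0 -scaleN1r bil_linl /bil !mul0mx !mxE; ring. Qed.

Variables (G : 'M[R]_(2 + 2)).
Hypothesis Gsym : G^T = G.
Hypothesis GJ : forall u v, bil G (Jv u) (Jv v) = bil G u v.

Lemma bil_sym u v : bil G u v = bil G v u.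
Proof.
rewrite /bil -[in LHS](trmxK (u *m G *m v^T)) mxE !trmx_mul trmxK Gsym mulmxA.
by [].
Qed.

Lemma bil_Jl u v : bil G (Jv u) v = - bil G u (Jv v).
Proof. by rewrite -GJ JvK bilNl. Qed.

Lemma hform_Jl u v : hform G (Jv u) v = ii * hform G u v.
Proof.
by apply: complexP; rewrite !(ReM, ImM) /= ?GJ ?bil_Jl; ring.
Qed.

Lemma hform_conj u v : conjc (hform G u v) = hform G v u.
Proof.
apply: complexP; rewrite !(Re_conjc, Im_conjc) /=; first exact: bil_sym.
by rewrite -bil_Jl bil_sym.
Qed.

Lemma hform_linl (a : R) u w v :
  hform G (a *: u + w) v = a%:C%C * hform G u v + hform G w v.
Proof.
by apply: complexP; rewrite !(ReD, ImD, ReM, ImM) /= !bil_linl; ring.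
Qed.

Lemma hform_expandl u v : hform G u v = \sum_i dz i u * hform G (ez i) v.
Proof.
apply: (@rlinear_expand _ (fun u => hform G u v)).
  by move=> a u1 u2; exact: hform_linl.
by move=> u1; exact: hform_Jl.
Qed.

Lemma hform_expandr u v : hform G u v = \sum_j hform G u (ez j) * conjc (dz j v).
Proof.
rewrite -[LHS]hform_conj hform_expandl conjc_sum; apply: eq_bigr => j _.
by rewrite conjcM hform_conj mulrC.
Qed.

Lemma hform_expand u v : hform G u v =
  \sum_i \sum_j hform G (ez i) (ez j) * dz i u * conjc (dz j v).
Proof.
rewrite hform_expandl; apply: eq_bigr => i _; rewrite hform_expandr mulr_sumr.
by apply: eq_bigr => j _; ring.
Qed.

End Hermitian.

(** * Wirtinger derivatives *)

Section Wirtinger.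
Context {R : realType}.
Local Notation C := R[i].
Local Notation ii := (Complex 0 1 : C).
Local Notation vect := 'rV[R]_(2 + 2).
Implicit Types (f g : vect -> C) (x : vect) (k l : 'I_2).

(** The operator d/dzbar^k: [ez k] is the direction of x^k and [Jv (ez k)] that of y^k. *)
Definition Dzb k f x : C := (Dc (ez k) f x + ii * Dc (Jv (ez k)) f x) / 2%:R.

Lemma DzE k f x : Dz k f x = (Dc (ez k) f x - ii * Dc (Jv (ez k)) f x) / 2%:R.
Proof. by rewrite /Dz dz_vec_sum Jv_ez. Qed.

Lemma Dz_conj (U : set vect) k f x : csmooth U f -> U x ->
  Dz k (fun y => conjc (f y)) x = conjc (Dzb k f x).
Proof.
move=> sf Ux; rewrite DzE /Dzb.
rewrite (is_DcE (is_Dc_conj (csmooth_is_Dc (ez k) sf Ux))).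
rewrite (is_DcE (is_Dc_conj (csmooth_is_Dc (Jv (ez k)) sf Ux))).
rewrite conjcM conjcD conjcM conjc_ii conjc_inv conjc_nat; ring.
Qed.

Lemma Dzb_conj (U : set vect) k f x : csmooth U f -> U x ->
  Dzb k (fun y => conjc (f y)) x = conjc (Dz k f x).
Proof.
move=> sf Ux; rewrite DzE /Dzb.
rewrite (is_DcE (is_Dc_conj (csmooth_is_Dc (ez k) sf Ux))).
rewrite (is_DcE (is_Dc_conj (csmooth_is_Dc (Jv (ez k)) sf Ux))).
rewrite conjcM conjcD conjcN conjcM conjc_ii conjc_inv conjc_nat; ring.
Qed.

Lemma csmooth_Dz (U : set vect) k f : open U -> csmooth U f -> csmooth U (Dz k f).
Proof.
move=> oU sf.
have S := csmoothD oU (csmooth_Dc (ez k) sf)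
  (csmoothM oU (csmooth_cst U (- ii)) (csmooth_Dc (Jv (ez k)) sf)).
apply: csmooth_eq (csmoothM oU S (csmooth_cst U (2%:R^-1))) => // x _.
by rewrite DzE mulNr.
Qed.

Lemma Dzb_Dz_comm (U : set vect) k l f x : open U -> U x -> csmooth U f ->
  Dzb l (Dz k f) x = Dz k (Dzb l f) x.
Proof.
move=> oU Ux sf.
have D v w : is_Dc x w (Dc v f) (Dc w (Dc v f) x).
  by apply: csmooth_is_Dc Ux; exact: csmooth_Dc.
have D1 w : is_Dc x w (Dz k f)
    ((Dc w (Dc (ez k) f) x + - ii * Dc w (Dc (Jv (ez k)) f) x) * 2%:R^-1).
  rewrite (_ : Dz k f = fun y => (Dc (ez k) f y + - ii * Dc (Jv (ez k)) f y) * 2%:R^-1).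
    by apply: is_DcMr; apply: is_DcD; [|apply: is_DcMl]; exact: D.
  by apply/funext => y; rewrite DzE mulNr.
have D2 w : is_Dc x w (Dzb l f)
    ((Dc w (Dc (ez l) f) x + ii * Dc w (Dc (Jv (ez l)) f) x) * 2%:R^-1).
  by apply: is_DcMr; apply: is_DcD; [|apply: is_DcMl]; exact: D.
rewrite DzE /Dzb !(is_DcE (D1 _)) !(is_DcE (D2 _)).
rewrite !(Dc_comm (ez l) _ oU Ux sf) !(Dc_comm (Jv (ez l)) _ oU Ux sf).
move: (Dc (ez k) (Dc (ez l) f) x) (Dc (ez k) (Dc (Jv (ez l)) f) x).
move: (Dc (Jv (ez k)) (Dc (ez l) f) x) (Dc (Jv (ez k)) (Dc (Jv (ez l)) f) x).
by move=> a b c d; ring.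
Qed.

Lemma Dzb_sum_mul (U : set vect) k x (I : finType) (f g : I -> vect -> C) :
  U x -> (forall s, csmooth U (f s)) -> (forall s, csmooth U (g s)) ->
  Dzb k (fun y => \sum_s f s y * g s y) x =
  \sum_s (Dzb k (f s) x * g s x + f s x * Dzb k (g s) x).
Proof.
move=> Ux sf sg.
have D w : is_Dc x w (fun y => \sum_s f s y * g s y)
    (\sum_s (Dc w (f s) x * g s x + f s x * Dc w (g s) x)).
  apply: is_Dc_sum => s; apply: is_DcM; first exact: csmooth_is_Dc (sf s) Ux.
  exact: csmooth_is_Dc (sg s) Ux.
rewrite /Dzb !(is_DcE (D _)) mulr_sumr -big_split mulr_suml.
by apply: eq_bigr => s _ /=; ring.
Qed.

End Wirtinger.

(** * The Levi-Civita equation in holomorphic coordinates *)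

Section KahlerChart.
Context {R : realType} (M : complex_surface R).
Local Notation C := R[i].
Local Notation ii := (Complex 0 1 : C).
Local Notation vect := 'rV[R]_(2 + 2).
Variables (g : kahler_metric M) (nabla : connection M).
Hypothesis LC : levi_civita g nabla.
Hypothesis CL : complex_linear nabla.
Variable z : chart R (2 + 2) M.
Hypothesis az : atlas z.
Implicit Types (x : vect) (i j k l s t : 'I_2).

Lemma atlas_open n (N : manifold R n) (phi : chart R n N) : atlas phi -> open (chart_image phi).
Proof. by move=> /atlas_chart []. Qed.

Let U := chart_image z.
Let oU : open U := atlas_open az.

Definition herm x i j : C := hform (metric g z x) (ez i) (ez j).
(** The symbol Gamma^s_(ki), read off from the real vectors d/dx^k and d/dx^i. Complex bilinearity
    makes it agree with the value on d/dz^k and d/dz^i, see [cchristoffelE]. *)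
Definition Gam s k i x : C := dz s (cov nabla z x (ez k) (ez i)).

Lemma smooth_bil u v : smooth_on U (fun x => bil (metric g z x) u v).
Proof.
have S : smooth_on U (fun x => \sum_b \sum_a u 0 a * metric g z x a b * v 0 b).
  apply: smooth_sum => // b _; apply: smooth_sum => // a _.
  apply: smoothM => //; last exact: smooth_cst.
  by apply: smoothM => //; [exact: smooth_cst|exact: (metric_smooth g az)].
by apply: smooth_eq S => // x _; rewrite bilE.
Qed.

Lemma csmooth_herm i j : csmooth U (fun x => herm x i j).
Proof. by split; exact: smooth_bil. Qed.

Lemma csmooth_Gam s k i : csmooth U (Gam s k i).
Proof.
have S a : smooth_on U (fun x => cov nabla z x (ez k) (ez i) 0 a).
  have S' : smooth_on U (fun x => \sum_b \sum_c
      ez k 0 b * ez i 0 c * christoffel nabla z x a b c).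
    apply: smooth_sum => // b _; apply: smooth_sum => // c _.
    by apply: smoothM => //; [exact: smooth_cst|exact: christoffel_smooth].
  by apply: smooth_eq S' => // x _; rewrite !mxE.
by split; exact: S.
Qed.

Lemma metric_sym x : U x -> (metric g z x)^T = metric g z x.
Proof. exact: metric_tr. Qed.

Lemma metric_J x : U x ->
  forall u v, bil (metric g z x) (Jv u) (Jv v) = bil (metric g z x) u v.
Proof. by move=> Ux u v; exact: metric_hermitian. Qed.

Lemma herm_conj x i j : U x -> conjc (herm x i j) = herm x j i.
Proof. by move=> Ux; apply: hform_conj; [exact: metric_sym|exact: metric_J]. Qed.

Lemma herm_conj_near i j x : U x ->
  {near x, (fun y => herm y i j) =1 (fun y => conjc (herm y j i))}.
Proof.
by apply: (near_eq_open oU) => y; rewrite inE => Uy; rewrite herm_conj.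
Qed.

Lemma hform_herm x u v : U x -> hform (metric g z x) u v =
  \sum_i \sum_j herm x i j * dz i u * conjc (dz j v).
Proof. by move=> Ux; apply: hform_expand; [exact: metric_sym|exact: metric_J]. Qed.

(** Parallelism of J concerns the differentiated field only. Absence of torsion exchanges the two
    arguments and so gives complex linearity in the direction of differentiation as well. *)
Lemma dz_cov_J x w i s : U x ->
  dz s (cov nabla z x (Jv w) (ez i)) = ii * dz s (cov nabla z x w (ez i)).
Proof.
move=> Ux; case: CL => tf cl.
by rewrite (tf z x (Jv w))// cl// dz_J (tf z x w).
Qed.

Lemma Gam_sym s k i x : U x -> Gam s k i x = Gam s i k x.
Proof. by move=> Ux; case: CL => tf cl; rewrite /Gam tf. Qed.

(** Metricity of the connection gives the real part, and the imaginary part follows from it because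
    J is parallel. *)
Lemma is_Dc_herm x w i j : U x -> is_Dc x w (fun y => herm y i j)
  (\sum_s dz s (cov nabla z x w (ez i)) * herm x s j +
   \sum_s herm x i s * conjc (dz s (cov nabla z x w (ez j)))).
Proof.
move=> Ux.
have hs := metric_sym Ux; have hJ := metric_J Ux.
rewrite -(hform_expandl hJ (cov nabla z x w (ez i)) (ez j)).
rewrite -(hform_expandr hs hJ (ez i)).
have sd u v : derivable (fun y => bil (metric g z y) u v) x w.
  exact: smooth_derivable (smooth_bil u v) Ux.
case: LC => _ lc; case: CL => _ cl.
split; apply: DeriveDef; do ?exact: sd.
  by rewrite ReD; exact: (lc z x (ez i) (ez j) w az Ux).
rewrite ImD; apply: (etrans (lc z x (ez i) (Jv (ez j)) w az Ux)).
by rewrite cl.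
Qed.

(** In [is_Dc_herm] the first sum is complex-linear and the second antilinear in the direction, by
    [dz_cov_J], so d/dz^k retains only the first. *)
Lemma Dz_herm x k i j : U x ->
  Dz k (fun y => herm y i j) x = \sum_s Gam s k i x * herm x s j.
Proof.
move=> Ux; rewrite DzE !(is_DcE (is_Dc_herm _ _ _ Ux)).
pose a := \sum_s Gam s k i x * herm x s j.
pose b := \sum_s herm x i s * conjc (Gam s k j x).
have -> : \sum_s dz s (cov nabla z x (Jv (ez k)) (ez i)) * herm x s j = ii * a.
  by rewrite mulr_sumr; apply: eq_bigr => s _; rewrite dz_cov_J// mulrA.
have -> : \sum_s herm x i s * conjc (dz s (cov nabla z x (Jv (ez k)) (ez j))) = - ii * b.
  rewrite mulr_sumr; apply: eq_bigr => s _; rewrite dz_cov_J// conjcM conjc_ii.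
  by rewrite mulrCA.
rewrite -/a -/b.
have -> : a + b - ii * (ii * a + - ii * b) = a * 2%:R + (ii * ii + 1) * (b - a) by ring.
by rewrite iiM addNr mul0r addr0 mulfK// pnatr_eq0.
Qed.

(* Up to sign, the left-hand side is the curvature with all indices lowered. *)
Lemma curvature_lowered x i j k l : U x ->
  \sum_s Dzb l (Gam s k i) x * herm x s j =
  Dzb l (Dz k (fun y => herm y i j)) x -
  \sum_s \sum_t Gam s k i x * conjc (Gam t l j x) * herm x s t.
Proof.
move=> Ux.
have E : {near x, Dz k (fun y => herm y i j) =1
                  (fun y => \sum_s Gam s k i y * herm y s j)}.
  by apply: (near_eq_open oU) Ux => y; rewrite inE => Uy; exact: Dz_herm.
have -> : Dzb l (Dz k (fun y => herm y i j)) x =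
          Dzb l (fun y => \sum_s Gam s k i y * herm y s j) x.
  by rewrite /Dzb !(Dc_near _ E).
rewrite (Dzb_sum_mul _ Ux); [|by move=> s; exact: csmooth_Gam|by move=> s; exact: csmooth_herm].
rewrite big_split /= -addrA -[LHS]addr0; congr (_ + _).
apply/esym/eqP; rewrite subr_eq0; apply/eqP; apply: eq_bigr => s _.
have -> : Dzb l (fun y => herm y s j) x = conjc (Dz l (fun y => herm y j s) x).
  rewrite -(Dzb_conj _ (csmooth_herm j s) Ux).
  by rewrite /Dzb !(Dc_near _ (herm_conj_near s j Ux)).
rewrite Dz_herm// conjc_sum mulr_sumr; apply: eq_bigr => t _.
by rewrite conjcM herm_conj// mulrA.
Qed.

(** In the formula of [curvature_lowered], conjugation turns d_lbar d_k h_(i jbar) into d_l d_kbar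
    h_(j ibar), and mixed Wirtinger derivatives commute. *)
Lemma curvature_lowered_conj x i j k l : U x ->
  conjc (\sum_s Dzb l (Gam s k i) x * herm x s j) =
  \sum_s Dzb k (Gam s l j) x * herm x s i.
Proof.
move=> Ux; rewrite !curvature_lowered// conjcD conjcN; congr (_ - _).
  rewrite -(Dz_conj _ (csmooth_Dz k oU (csmooth_herm i j)) Ux).
  rewrite (Dzb_Dz_comm _ _ oU Ux (csmooth_herm j i)).
  have E : {near x, (fun y => conjc (Dz k (fun y => herm y i j) y)) =1
                    Dzb k (fun y => herm y j i)}.
    apply: (near_eq_open oU) Ux => y; rewrite inE => Uy.
    rewrite -(Dzb_conj _ (csmooth_herm i j) Uy).
    by rewrite /Dzb !(Dc_near _ (herm_conj_near j i Uy)).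
  by rewrite !DzE !(Dc_near _ E).
rewrite conjc_sum [RHS]exchange_big; apply: eq_bigr => s _.
rewrite conjc_sum; apply: eq_bigr => t _.
by rewrite !conjcM conjcK herm_conj// [in LHS](mulrC (conjc _)).
Qed.

(** A vector [v] in the left kernel of the hermitian matrix consists of the dz-components of a real
    vector [u] with g(u, .) = 0, and g is nondegenerate. *)
Lemma herm_unit x : U x -> (\matrix_(i, j) herm x i j) \in unitmx.
Proof.
move=> Ux; rewrite unitmxE unitfE; apply/negP => /det0P [v v0 vH].
have nG := metric_nondeg g az Ux.
pose u := cvec (v 0).
have u0 : u *m metric g z x = 0.
  apply/rowP => a; have := hform_herm u (delta_mx 0 a) Ux.
  rewrite exchange_big big1 => [|j _].
    move=> /(congr1 (@complex.Re R)) /= /eqP.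
    rewrite /bil mxE (bigD1 a)//= big1 => [|b ba].
      by rewrite !mxE !eqxx mulr1 addr0 => /eqP.
    by rewrite !mxE (negPf ba) andbF mulr0.
  have E : \sum_i v 0 i * herm x i j = 0.
    have := congr1 (fun w : 'rV_2 => w 0 j) vH; rewrite !mxE => E.
    by rewrite -[RHS]E; apply: eq_bigr => i _; rewrite mxE.
  rewrite -mulr_suml (eq_bigr (fun i => v 0 i * herm x i j)) ?E ?mul0r// => i _.
  by rewrite dz_cvec mulrC.
have := mulmxK nG u; rewrite u0 mul0mx => /esym uE.
case/eqP: v0; apply/rowP => i; rewrite mxE -(dz_cvec (v 0) i) -/u uE.
by apply: complexP; rewrite /= !mxE.
Qed.

Lemma dz_coordE s (u : vect) : dz s u = \sum_a (u 0 a)%:C%C * dz s (delta_mx 0 a).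
Proof.
have dzD u1 u2 : dz s (u1 + u2) = dz s u1 + dz s u2.
  by rewrite -[u1 in LHS]scale1r dz_lin mul1r.
have dz0 : dz s 0 = 0 :> C by apply: complexP; rewrite /= mxE.
rewrite {1}(row_sum_delta u).
elim: (index_enum _) => [|a r IH]; first by rewrite !big_nil.
by rewrite !big_cons dzD IH -[_ *: _]addr0 dz_lin dz0 addr0.
Qed.

(** The sums over real indices are two Wirtinger averages of a complex-bilinear map, and each
    average (b - i (i b)) / 2 returns b. *)
Lemma cchristoffelE s k i x : U x -> cchristoffel nabla z s k i x = Gam s k i x.
Proof.
move=> Ux; pose X u v := dz s (cov nabla z x u v).
have -> : cchristoffel nabla z s k i x =
    \sum_b dz_vec k b * (\sum_c dz_vec i c * X (delta_mx 0 b) (delta_mx 0 c)).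
  rewrite /cchristoffel exchange_big; apply: eq_bigr => b _.
  rewrite mulr_sumr exchange_big; apply: eq_bigr => c _.
  have -> : X (delta_mx 0 b) (delta_mx 0 c) =
      \sum_a (christoffel nabla z x a b c)%:C%C * dz s (delta_mx 0 a).
    rewrite /X (dz_coordE s); apply: eq_bigr => a _; rewrite mxE; congr (_%:C%C * _).
    rewrite (bigD1 b)//= (bigD1 c)//= !big1 => [|b' bb|c' cc]; rewrite ?mxE ?eqxx /=.
    - by rewrite !mul1r !addr0.
    - by apply: big1 => c' _; rewrite ?mxE (negPf bb) ?andbF !mul0r.
    - by rewrite ?mxE (negPf cc) ?andbF mulr0 mul0r.
  by rewrite !mulr_sumr; apply: eq_bigr => a _; ring.
rewrite dz_vec_sum !dz_vec_sum -!Jv_ez.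
have XJr u v : X u (Jv v) = ii * X u v by rewrite /X; case: CL => _ cl; rewrite cl// dz_J.
have XJl u v : X (Jv u) v = ii * X u v.
  by rewrite /X; case: CL => tf cl; rewrite tf// cl// dz_J tf.
rewrite !XJr !XJl ?XJr -/(ez k) -/(ez i) -[Gam _ _ _ _]/(X (ez k) (ez i)).
move: (X (ez k) (ez i)) => a.
have half (b : C) : (b - ii * (ii * b)) / 2%:R = b.
  rewrite mulrA iiM mulN1r opprK -mulr2n -[b *+ 2]mulr_natr mulfK//.
by rewrite !half.
Qed.

End KahlerChart.

(** * The linear system in a chart *)

Section WeylAlgebra.
Context {R : realType}.
Local Notation C := R[i].
Local Notation cc := (@conjc R).
Variables (H : 'M[C]_2) (D : 'I_2 -> 'I_2 -> 'I_2 -> 'I_2 -> C).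
Hypothesis Hc : forall i j, cc (H i j) = H j i.
Hypothesis Hu : H \in unitmx.
Hypothesis Dsym : forall s k i l, D s k i l = D s i k l.
Hypothesis Dconj : forall k i l j,
  cc (\sum_s D s k i l * H s j) = \sum_s D s l j k * H s i.

(** With [D s k i l] read as d_lbar Gamma^s_(ki), this is up to sign the curvature lowered by [H]:
    [a], [b] are holomorphic indices, [c], [d] antiholomorphic ones, and [c] is the lowered
    index. *)
Let Q a b c d := \sum_s D s a b d * H s c.

Let Q_conj a b c d : cc (Q a b c d) = Q d c b a.
Proof. exact: Dconj. Qed.

Let Q_sym a b c d : Q a b c d = Q b a c d.
Proof. by apply: eq_bigr => s _; rewrite Dsym. Qed.

(** The symmetry of the Christoffel symbols, carried to the barred pair by conjugation. *)
Let Q_symr a b c d : Q a b c d = Q a b d c.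
Proof. by rewrite -[LHS](@conjcK R) Q_conj Q_sym Q_conj. Qed.

Let N := invmx H.

Let N_conj i j : cc (N i j) = N j i.
Proof.
have HE : (map_mx cc H)^T = H by apply/matrixP => a b; rewrite !mxE Hc.
have : (map_mx cc N)^T = N by rewrite /N map_invmx trmx_inv HE.
by move=> NE; rewrite -[in RHS]NE !mxE.
Qed.

Let T k l := \sum_s D s s k l.

(** The inverse of [H] raises the lowered index again, so the trace of [D], a Ricci tensor up to
    sign, is a contraction of [Q] with a hermitian matrix. This is what makes [T] hermitian. *)
Let TE k l : T k l = \sum_s \sum_j Q s k j l * N j s.
Proof.
apply: eq_bigr => s _; rewrite /Q.
under eq_bigr do rewrite mulr_suml.
rewrite exchange_big (bigD1 s)//= [X in _ + X]big1 => [|t ts].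
  have /matrixP/(_ s s) := mulmxV Hu; rewrite !mxE eqxx => E.
  rewrite addr0; transitivity (D s s k l * \sum_j H s j * N j s).
    by rewrite E mulr1.
  by rewrite mulr_sumr; apply: eq_bigr => j _; rewrite mulrA.
have /matrixP/(_ t s) := mulmxV Hu; rewrite !mxE (negPf ts) => E.
transitivity (D t s k l * \sum_j H t j * N j s); last by rewrite E mulr0.
by rewrite mulr_sumr; apply: eq_bigr => j _; rewrite mulrA.
Qed.

Let T_conj k l : cc (T k l) = T l k.
Proof.
rewrite !TE conjc_sum [RHS]exchange_big; apply: eq_bigr => s _.
rewrite conjc_sum; apply: eq_bigr => j _.
by rewrite conjcM N_conj Q_conj Q_sym Q_symr.
Qed.

(** The factor 1/3 makes the tensor trace-free: in complex dimension 2 the correction in brackets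
    has trace 3 T over the upper and one lower index. *)
Definition weyl_tensor s i k l : C :=
  - (D s i k l - 3%:R^-1 * (T i l * (s == k)%:R + T k l * (s == i)%:R)).

Let weyl_lowered i k l j : \sum_s H s j * weyl_tensor s i k l =
  - Q i k j l + 3%:R^-1 * (T i l * H k j + T k l * H i j).
Proof.
have delta (k' : 'I_2) (a : C) : \sum_s H s j * (a * (s == k')%:R) = a * H k' j.
  rewrite (bigD1 k')//= big1 => [|s sk]; first by rewrite eqxx mulr1 addr0 mulrC.
  by rewrite (negPf sk) !mulr0.
rewrite -!delta -big_split /= mulr_sumr /Q -sumrN -big_split.
apply: eq_bigr => s _ /=; rewrite /weyl_tensor; ring.
Qed.

(** Each symmetrised sum on the left is - 2 Q plus a third of the sum of four products of [T] and
    [H], and this expression is hermitian under exchange of the pairs (i, k) and (j, l). *)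
Lemma weyl_system i j k l :
  \sum_s H s j * weyl_tensor s i k l + \sum_s H s l * weyl_tensor s i k j =
  cc (\sum_s H s k * weyl_tensor s j l i + \sum_s H s i * weyl_tensor s j l k).
Proof.
rewrite !weyl_lowered !(conjcD, conjcN, conjcM, Q_conj, T_conj, Hc).
rewrite conjc_inv conjc_nat (Q_symr i k j l) (Q_sym k i l j).
move: (Q i k l j) (T i l) (T k l) (T i j) (T k j) (H k j) (H i j) (H k l) (H i l).
by move=> *; ring.
Qed.

End WeylAlgebra.

(** * Invariance of the linear system under a change of frame *)

Section FrameChange.
Context {R : realType}.
Local Notation C := R[i].
Local Notation cc := (@conjc R).

Lemma sum4_rot (f : 'I_2 -> 'I_2 -> 'I_2 -> 'I_2 -> C) :
  \sum_n \sum_r \sum_t \sum_q f n r t q = \sum_q \sum_t \sum_n \sum_r f n r t q.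
Proof.
transitivity (\sum_t \sum_q \sum_n \sum_r f n r t q); last first.
  exact: exchange_big.
rewrite pair_bigA /= [RHS]pair_bigA /= [RHS](eq_bigr (fun p => \sum_u f u.1 u.2 p.1 p.2)).
  rewrite [RHS]exchange_big /=; apply: eq_bigr => u _.
  by rewrite pair_bigA.
by move=> p _; rewrite pair_bigA.
Qed.

Lemma sum_rot3 (h : 'I_2 -> C) (f : 'I_2 -> 'I_2 -> 'I_2 -> 'I_2 -> C) :
  \sum_m h m * (\sum_n \sum_r \sum_t f n r t m) =
  \sum_n \sum_r \sum_t \sum_m h m * f n r t m.
Proof.
under eq_bigr do rewrite mulr_sumr.
rewrite exchange_big; apply: eq_bigr => n _.
under eq_bigr do rewrite mulr_sumr.
rewrite exchange_big; apply: eq_bigr => r _.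
under eq_bigr do rewrite mulr_sumr.
by rewrite exchange_big.
Qed.

Lemma sum_mul_mulmx (F : 'I_2 -> C) (A B : 'M[C]_2) b : A *m B = 1%:M ->
  \sum_r (\sum_l F l * A l r) * B r b = F b.
Proof.
move=> AB; have /rowP/(_ b) := congr1 (mulmx (\row_l F l)) AB.
rewrite mulmx1 mulmxA !mxE => <-; apply: eq_bigr => r _; rewrite mxE.
by congr (_ * _); apply: eq_bigr => l _; rewrite mxE.
Qed.

Variables (H E Ei : 'M[C]_2) (W W' : 'I_2 -> 'I_2 -> 'I_2 -> 'I_2 -> C).
Hypothesis EiE : Ei *m E = 1%:M.
Hypothesis Wsys : forall i j k l,
  \sum_s H s j * W s i k l + \sum_s H s l * W s i k j =
  cc (\sum_s H s k * W s j l i + \sum_s H s i * W s j l k).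
(* [W'] consists of the components of [W] in the coframe [Ei dz]. *)
Hypothesis W'E : forall i k r t,
  \sum_l \sum_j W' i k l j * Ei l r * cc (Ei j t) =
  \sum_m \sum_n Ei i m * W m n r t * E n k.

Let H' i j := \sum_a \sum_b H a b * E a i * cc (E b j).

Let EE : E *m Ei = 1%:M. Proof. exact: mulmx1C. Qed.

Let cEiE : map_mx cc Ei *m map_mx cc E = 1%:M.
Proof. by rewrite -map_mxM EiE map_mx1. Qed.

Let Z i k l m := \sum_n \sum_r \sum_t E n i * E r k * cc (E t l) * W m n r t.

(** [W'E] determines [W'] because [Ei] is inverted by [E] in the holomorphic slot and by the
    conjugate of [E] in the antiholomorphic one. *)
Let W'_expand s i k l : W' s i k l = \sum_m Ei s m * Z i k l m.
Proof.
rewrite -[LHS](sum_mul_mulmx (fun a => W' s i a l) k EiE).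
have inner r : \sum_a W' s i a l * Ei a r =
    \sum_t (\sum_m \sum_n Ei s m * W m n r t * E n i) * cc (E t l).
  rewrite -[LHS](sum_mul_mulmx (fun b => \sum_a W' s i a b * Ei a r) l cEiE).
  apply: eq_bigr => t _; rewrite -W'E; congr (_ * _); last by rewrite mxE.
  rewrite exchange_big; apply: eq_bigr => b _; rewrite mxE mulr_suml.
  by [].
under eq_bigr do rewrite inner.
rewrite /Z sum_rot3 [RHS]exchange_big; apply: eq_bigr => r _.
rewrite mulr_suml [RHS]exchange_big; apply: eq_bigr => t _.
rewrite [RHS]exchange_big !mulr_suml; apply: eq_bigr => m _.
by rewrite !mulr_suml; apply: eq_bigr => n _;
  move: (Ei s m) (W m n r t) (E n i) (cc (E t l)) (E r k) => *; ring.
Qed.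

(** The upper index of [W'] carries [Ei] and the metric carries [E]. They cancel in the contraction,
    so the lowered tensor transforms by [E] and its conjugate alone. *)
Let W'_lowered i k l j : \sum_s H' s j * W' s i k l =
  \sum_n \sum_r \sum_t \sum_q
     E n i * E r k * cc (E t l) * cc (E q j) * \sum_s H s q * W s n r t.
Proof.
transitivity (\sum_q cc (E q j) * \sum_m H m q * Z i k l m).
  have H'E s : H' s j = \sum_q cc (E q j) * (\sum_a H a q * E a s).
    rewrite /H' exchange_big; apply: eq_bigr => q _; rewrite mulr_sumr.
    by apply: eq_bigr => a _; rewrite mulrC.
  have HE q m : H m q = \sum_s (\sum_a H a q * E a s) * Ei s m.
    by rewrite (sum_mul_mulmx (fun a => H a q) m EE).
  rewrite [RHS](eq_bigr (fun q => \sum_m \sum_s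
      cc (E q j) * (\sum_a H a q * E a s) * Ei s m * Z i k l m)) => [|q _].
    rewrite [RHS]exchange_big; under [RHS]eq_bigr do rewrite exchange_big.
    rewrite [RHS]exchange_big; apply: eq_bigr => s _; rewrite H'E W'_expand.
    rewrite mulr_sumr; apply: eq_bigr => m _; rewrite !mulr_suml.
    by apply: eq_bigr => q _; rewrite mulrA.
  rewrite mulr_sumr; apply: eq_bigr => m _; rewrite HE mulr_suml mulr_sumr.
  by apply: eq_bigr => s _; rewrite !mulrA.
under eq_bigr do rewrite /Z sum_rot3.
rewrite sum_rot3; apply: eq_bigr => n _; apply: eq_bigr => r _.
apply: eq_bigr => t _; apply: eq_bigr => q _; rewrite mulr_sumr [RHS]mulr_sumr.
by apply: eq_bigr => m _;
  move: (H m q) (W m n r t) (E n i) (cc (E t l)) (E r k) (cc (E q j)) => *; ring.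
Qed.

(** Conjugation interchanges the factors [E] with their conjugates, so after a relabelling of the
    summation indices both sides carry the same factors and [Wsys] applies term by term. *)
Lemma weyl_system_frame i j k l :
  \sum_s H' s j * W' s i k l + \sum_s H' s l * W' s i k j =
  cc (\sum_s H' s k * W' s j l i + \sum_s H' s i * W' s j l k).
Proof.
pose Y n r t q := \sum_s H s q * W s n r t + \sum_s H s t * W s n r q.
have YE i' j' k' l' : \sum_s H' s j' * W' s i' k' l' + \sum_s H' s l' * W' s i' k' j' =
   \sum_n \sum_r \sum_t \sum_q E n i' * E r k' * cc (E t l') * cc (E q j') * Y n r t q.
  rewrite !W'_lowered -big_split; apply: eq_bigr => n _.
  rewrite -big_split; apply: eq_bigr => r _ /=.
  rewrite [X in _ + X]exchange_big /=.
  rewrite -big_split; apply: eq_bigr => t _; rewrite -big_split; apply: eq_bigr => q _ /=.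
  rewrite /Y; move: (\sum_s H s q * _) (\sum_s H s t * _).
  by move: (E n i') (E r k') (cc (E t l')) (cc (E q j')) => *; ring.
rewrite YE [X in cc X]YE sum4_rot.
have conj4 (f : 'I_2 -> 'I_2 -> 'I_2 -> 'I_2 -> C) :
  cc (\sum_n \sum_r \sum_t \sum_q f n r t q) = \sum_n \sum_r \sum_t \sum_q cc (f n r t q).
  by do 4!(rewrite conjc_sum; apply: eq_bigr => ? _).
rewrite conj4; apply: eq_bigr => q _; apply: eq_bigr => t _; apply: eq_bigr => n _.
apply: eq_bigr => r _; rewrite !conjcM !conjcK /Y Wsys; congr (_ * _).
by move: (E n i) (E r k) (cc (E t l)) (cc (E q j)) => *; ring.
Qed.

End FrameChange.

Section DzbAffine.
Context {R : realType}.
Local Notation C := R[i].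
Local Notation vect := 'rV[R]_(2 + 2).

(** Modelled on the expression of [Pi3] in the Christoffel symbols, with [a] and [b] in the place of
    the Kronecker deltas. *)
Lemma Dzb_affine (U : set vect) l x (f h : vect -> C) (A B : 'I_2 -> vect -> C) (c a b : C) :
  open U -> U x -> csmooth U h -> (forall t, csmooth U (A t)) ->
  (forall t, csmooth U (B t)) ->
  {in U, (fun y => h y - c * (\sum_t A t y * a + \sum_t B t y * b)) =1 f} ->
  Dzb l f x = Dzb l h x - c * ((\sum_t Dzb l (A t) x) * a + (\sum_t Dzb l (B t) x) * b).
Proof.
move=> oU Ux sh sA sB fE.
have D w : Dc w f x =
    Dc w h x - c * ((\sum_t Dc w (A t) x) * a + (\sum_t Dc w (B t) x) * b).
  rewrite !mulr_suml; apply: is_DcE; apply: is_Dc_near (near_eq_open oU fE Ux) _.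
  rewrite -mulNr (_ : (fun y => _) =
     (fun y => h y + - c * (\sum_t A t y * a + \sum_t B t y * b))); last first.
    by apply/funext => y; rewrite mulNr.
  apply: is_DcD; first exact: csmooth_is_Dc sh Ux.
  apply: is_DcMl; apply: is_DcD; apply: is_Dc_sum => t; apply: is_DcMr.
    exact: csmooth_is_Dc (sA t) Ux.
  exact: csmooth_is_Dc (sB t) Ux.
rewrite /Dzb !D; move: (ez l) (Jv (ez l)) => e1 e2.
rewrite -!mulr_suml !big_split /= -!mulr_sumr.
move: (\sum_t Dc e1 (A t) x) (\sum_t Dc e2 (A t) x).
move: (\sum_t Dc e1 (B t) x) (\sum_t Dc e2 (B t) x).
by move: (Dc e1 h x) (Dc e2 h x) => *; ring.
Qed.

End DzbAffine.

(** * Weyl curvature of the Levi-Civita connection in a chart *)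

Section ChartWeyl.
Context {R : realType} (M : complex_surface R).
Local Notation C := R[i].
Local Notation vect := 'rV[R]_(2 + 2).
Variables (g : kahler_metric M) (nabla : connection M).
Hypothesis LC : levi_civita g nabla.
Hypothesis CL : complex_linear nabla.
Variable z : chart R (2 + 2) M.
Hypothesis az : atlas z.
Let U := chart_image z.
Let oU : open U := atlas_open az.

Lemma Pi3E i j k : {in U, (fun x => Gam nabla z i j k x -
  3%:R^-1 * (\sum_l Gam nabla z l l j x * (i == k)%:R +
             \sum_l Gam nabla z l l k x * (i == j)%:R)) =1 Pi3 nabla z i j k}.
Proof.
move=> x; rewrite inE => Ux; rewrite /Pi3 (cchristoffelE CL)//.
by under eq_bigr do rewrite -(cchristoffelE CL)//;
   under [X in _ * (_ + X)]eq_bigr do rewrite -(cchristoffelE CL)//.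
Qed.

Lemma csmooth_Pi3 i j k : csmooth U (Pi3 nabla z i j k).
Proof.
apply: csmooth_eq (@Pi3E i j k) _ => //.
apply: csmoothD => //; first exact: csmooth_Gam.
apply: csmoothN => //; apply: csmoothM => //; first exact: csmooth_cst.
by apply: csmoothD => //; apply: csmooth_sum => // l; apply: csmoothM => //;
  do ?[exact: csmooth_cst|exact: csmooth_Gam].
Qed.

Lemma weyl_tensorE x s i k l : U x ->
  - Dzb l (Pi3 nabla z s i k) x =
  weyl_tensor (fun s k i l => Dzb l (Gam nabla z s k i) x) s i k l.
Proof.
move=> Ux; rewrite /weyl_tensor; congr (- _).
have S a b c := csmooth_Gam nabla az a b c.
have := Dzb_affine l oU Ux (S s i k) (fun t => S t t i) (fun t => S t t k) (@Pi3E s i k).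
exact.
Qed.

Lemma chart_weyl_system x (W : 'I_2 -> 'I_2 -> 'I_2 -> 'I_2 -> C) (H : 'M[C]_2) i j k l :
  (forall s i k l, W s i k l = - Dzb l (Pi3 nabla z s i k) x) ->
  H = \matrix_(i, j) herm g z x i j -> U x ->
  \sum_s H s j * W s i k l + \sum_s H s l * W s i k j =
  conjc (\sum_s H s k * W s j l i + \sum_s H s i * W s j l k).
Proof.
move=> WE -> Ux.
have -> : W = weyl_tensor (fun s k i l => Dzb l (Gam nabla z s k i) x).
  do 4!(apply/funext => ?); by rewrite WE weyl_tensorE.
apply: weyl_system.
- by move=> a b; rewrite !mxE herm_conj.
- exact: herm_unit.
- move=> a b c d; rewrite /Dzb.
  have E : {near x, Gam nabla z a b c =1 Gam nabla z a c b}.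
    by apply: (near_eq_open oU) Ux => y; rewrite inE => Uy; exact: Gam_sym.
  by rewrite !(Dc_near _ E).
- move=> a b c d; have := curvature_lowered_conj LC CL az b d a c Ux.
  by move=> E; under eq_bigr do rewrite mxE; under [RHS]eq_bigr do rewrite mxE.
Qed.

End ChartWeyl.

(** * Sections of the Cartan bundle *)

Section Pullback.
Context {R : realType}.
Local Notation C := R[i].

Lemma smooth_mx_chain (V : normedModType R) n p (O : set 'rV[R]_n)
    (G : 'rV[R]_n -> 'rV[R]_p) (f : V -> 'rV[R]_n) x v :
  open O -> smooth_mx O G -> O (f x) -> derivable f x v ->
  'D_v (G \o f) x = 'D_('D_v f x) G (f x) /\ derivable (G \o f) x v.
Proof.
move=> oO sG Ofx df.
have D a := chain_rule_is oO Ofx (sG 0 a 1%N) df.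
have dGf : derivable (G \o f) x v.
  by apply/derivable_mxP => i a; rewrite (ord1 i); have [] := D a.
split=> //; apply/rowP => a; rewrite derive_mx// mxE (smooth_mx_deriveE _ _ sG Ofx).
by have [_ <-] := D a.
Qed.

(** The exterior derivative commutes with pull-back, here on the constant fields [u] and [v]. The
    second derivatives of [F] are collected in [P] below and cancel by symmetry. *)
Lemma pullback_d m n (O : set 'rV[R]_m) (O' : set 'rV[R]_n)
    (F : 'rV[R]_m -> 'rV[R]_n) (eta : 'rV[R]_n -> 'rV[R]_n -> C) x u v :
  open O -> open O' -> smooth_mx O F -> (forall y, O y -> O' (F y)) ->
  (forall w, csmooth O' (eta^~ w)) ->
  (forall y (a : R) w1 w2, O' y -> eta y (a *: w1 + w2) = a%:C%C * eta y w1 + eta y w2) ->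
  O x ->
  Dc u (fun y => eta (F y) ('D_v F y)) x - Dc v (fun y => eta (F y) ('D_u F y)) x =
  Dc ('D_u F x) (eta^~ ('D_v F x)) (F x) - Dc ('D_v F x) (eta^~ ('D_u F x)) (F x).
Proof.
move=> oO oO' sF FO seta leta Ox.
have etaE y w : O' y -> eta y w = \sum_a (w 0 a)%:C%C * eta y (delta_mx 0 a).
  move=> Oy.
  have eta0 : eta y 0 = 0.
    have := leta y 1 0 0 Oy; rewrite scaler0 addr0 mul1r => /eqP.
    by rewrite -subr_eq0 opprD addNKr oppr_eq0 => /eqP.
  rewrite {1}(row_sum_delta w).
  elim: (index_enum _) => [|a r IH]; first by rewrite !big_nil.
  by rewrite !big_cons leta// IH.
have D w w' : is_Dc x w (fun y => eta (F y) ('D_w' F y))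
   (\sum_a (('D_w ('D_w' (fun y => F y 0 a)) x)%:C%C * eta (F x) (delta_mx 0 a) +
            (('D_w' F x) 0 a)%:C%C * Dc ('D_w F x) (eta^~ (delta_mx 0 a)) (F x))).
  have E : {near x, (fun y => \sum_a
        ('D_w' (fun y => F y 0 a) y)%:C%C * eta (F y) (delta_mx 0 a))
      =1 (fun y => eta (F y) ('D_w' F y))}.
    apply: (near_eq_open oO) Ox => y; rewrite inE => Oy.
    rewrite [RHS]etaE; last exact: FO.
    by apply: eq_bigr => a _; rewrite (smooth_mx_deriveE _ _ sF Oy).
  apply: is_Dc_near E _; apply: is_Dc_sum => a.
  rewrite (smooth_mx_deriveE _ _ sF Ox); apply: is_DcM.
    have [_] := csmooth_is_Dc w (csmooth_real (smooth_derive w' (sF 0 a))) Ox.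
    move=> _; split; last exact: is_derive_cst.
    by apply: derivableP; apply: smooth_derivable Ox; exact: smooth_derive.
  apply: is_Dc_chain oO' _ (seta _) _; first exact: FO.
  exact: smooth_mx_derivable sF Ox.
have D' w w' : \sum_a (('D_w' F x) 0 a)%:C%C * Dc w (eta^~ (delta_mx 0 a)) (F x) =
    Dc w (eta^~ ('D_w' F x)) (F x).
  apply/esym/is_DcE.
  have E : {near F x, (fun y => \sum_a (('D_w' F x) 0 a)%:C%C * eta y (delta_mx 0 a))
      =1 eta^~ ('D_w' F x)}.
    apply: (near_eq_open oO') (FO _ Ox) => y; rewrite inE => Oy.
    by rewrite [RHS]etaE.
  apply: is_Dc_near E _; apply: is_Dc_sum => a; apply: is_DcMl.
  exact: csmooth_is_Dc (seta _) (FO _ Ox).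
pose P w w' := \sum_a ('D_w ('D_w' (fun y => F y 0 a)) x)%:C%C * eta (F x) (delta_mx 0 a).
have E w w' : Dc w (fun y => eta (F y) ('D_w' F y)) x =
    P w w' + Dc ('D_w F x) (eta^~ ('D_w' F x)) (F x).
  by apply: etrans (is_DcE (D w w')) _; rewrite big_split /=; congr (_ + _); exact: D'.
have PC : P v u = P u v.
  by apply: eq_bigr => a _; rewrite (derive_comm v u oO Ox (sF 0 a 2%N)).
transitivity (P u v + Dc ('D_u F x) (eta^~ ('D_v F x)) (F x) -
             (P v u + Dc ('D_v F x) (eta^~ ('D_u F x)) (F x))).
  by congr (_ - _); exact: E.
by rewrite PC opprD addrACA subrr add0r.
Qed.

End Pullback.

(** * Smooth maps into manifolds, read in charts *)

Section SmoothInto.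
Context {R : realType}.

Lemma smooth_mx_sub (V : normedModType R) m n (U U' : set V) (f : V -> 'M[R]_(m, n)) :
  U' `<=` U -> smooth_mx U f -> smooth_mx U' f.
Proof. by move=> sU sf i j; exact: smooth_sub (sf i j). Qed.

Lemma smooth_into_open (V : normedModType R) n (N : manifold R n) (O : set V)
    (f : V -> N) (psi : chart R n N) : open O -> smooth_into O f -> atlas psi ->
  open (O `&` f @^-1` chart_dom psi).
Proof.
move=> oO [cf _] /atlas_chart [odom _ _ _ _].
rewrite openE => x [Ox fx]; apply: filterI; first exact: open_nbhs_nbhs.
by apply: cf => //; exact: open_nbhs_nbhs.
Qed.

Lemma chart_fwd n (N : manifold R n) (phi : chart R n N) (q : N) : chart_dom phi q ->
  chart_image phi (fwd phi q).
Proof. by move=> dq; exists q. Qed.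

Lemma chart_bwd n (N : manifold R n) (phi : chart R n N) x : atlas phi -> chart_image phi x ->
  chart_dom phi (bwd phi x) /\ fwd phi (bwd phi x) = x.
Proof.
by move=> /atlas_chart [_ _ bK _ _] [q dq <-]; rewrite bK.
Qed.

Lemma chart_fwdK n (N : manifold R n) (phi : chart R n N) (q : N) : atlas phi -> chart_dom phi q ->
  bwd phi (fwd phi q) = q.
Proof. by move=> /atlas_chart [_ _ bK _ _]; exact: bK. Qed.

Lemma smooth_into_bwd n (N : manifold R n) (phi : chart R n N) : atlas phi ->
  smooth_into (chart_image phi) (bwd phi).
Proof.
move=> aphi; split; first by case: (atlas_chart aphi).
move=> psi apsi; apply: smooth_mx_sub (atlas_smooth aphi apsi).
move=> x [Ix dx]; have [d1 E] := chart_bwd aphi Ix.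
by exists (bwd phi x).
Qed.

Lemma smooth_into_map m n (M : manifold R m) (N : manifold R n) (D : set M)
    (f : M -> N) (phi : chart R m M) : atlas phi -> chart_dom phi `<=` D -> smooth_map D f ->
  smooth_into (chart_image phi) (f \o bwd phi).
Proof.
move=> aphi sD [cf sf]; split.
  move=> x Ix; have [d1 _] := chart_bwd aphi Ix.
  apply: continuous_comp; last by apply: cf; exact: sD.
  by case: (atlas_chart aphi) => _ _ _ _; exact.
move=> psi apsi; apply: smooth_mx_sub (sf phi psi aphi apsi).
move=> x [Ix dx]; have [d1 E] := chart_bwd aphi Ix.
by exists (bwd phi x) => //; split=> //; split=> //; exact: sD.
Qed.

End SmoothInto.

Section Sections.
Context {R : realType} (M : complex_surface R) (B : principal_bundle M).
Variable theta : mxform B.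
Hypothesis CC : cartan_connection theta.

Section ShiftedSection.
Variables (z : chart R (2 + 2) M) (s : M -> B) (p : 'M[R[i]]_3).
Hypothesis az : atlas z.
Hypothesis ss : smooth_map (chart_dom z) s.
Hypothesis sK : forall y, chart_dom z y -> pb_proj (s y) = y.
Hypothesis pp : parabolic p.
Let U := chart_image z.

Definition shifted_section x := pb_act (s (bwd z x)) p.

Lemma smooth_section : smooth_into U (s \o bwd z).
Proof. exact: smooth_into_map ss. Qed.

Lemma smooth_shifted_section : smooth_into U shifted_section.
Proof.
apply: (@pb_act_smooth _ _ B _ U (s \o bwd z) (fun=> p)).
- exact: atlas_open.
- exact: smooth_section.
- by move=> i j; split; exact: smooth_cst.
- by move=> t _.
Qed.

Lemma proj_shifted_section x : U x -> pb_proj (shifted_section x) = bwd z x.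
Proof.
move=> Ux; have [dx _] := chart_bwd az Ux; rewrite -[RHS](sK dx).
by apply/esym/pb_fibre; exists p.
Qed.

(** Near [x] the shifted section is [s] followed by right translation by [p]; the chain rule in
    charts reduces the claim to the equivariance axiom. *)
Lemma section_equivariant x w phi psi : U x -> atlas phi -> atlas psi ->
  chart_dom phi (s (bwd z x)) -> chart_dom psi (shifted_section x) ->
  theta psi (fwd psi (shifted_section x)) ('D_w (fwd psi \o shifted_section) x) =
  invmx p *m theta phi (fwd phi (s (bwd z x))) ('D_w (fwd phi \o s \o bwd z) x) *m p.
Proof.
move=> Ux aphi apsi dphi dpsi; have oU : open U by exact: atlas_open.
rewrite -(cartan_equivariant CC _ pp aphi apsi dphi dpsi).
pose G y := pb_act (bwd phi y) p.
have sG : smooth_into (chart_image phi) G.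
  apply: (@pb_act_smooth _ _ B _ _ (bwd phi) (fun=> p)).
  - exact: atlas_open.
  - exact: smooth_into_bwd.
  - by move=> i j; split; exact: smooth_cst.
  - by move=> t _.
have oG := smooth_into_open (atlas_open aphi) sG apsi.
have oO := smooth_into_open oU smooth_section aphi.
have E : {near x, fwd psi \o shifted_section =1 (fwd psi \o G) \o (fwd phi \o s \o bwd z)}.
  apply: (near_eq_open oO); last by split.
  by move=> y; rewrite inE => -[Uy dy] /=; rewrite /G chart_fwdK.
rewrite (near_eq_derive _ E).
have [|| -> _] // := smooth_mx_chain oG (sG.2 psi apsi)
  (f := fwd phi \o s \o bwd z) (x := x) (v := w).
  by split; [exact: chart_fwd|rewrite /= /G chart_fwdK].
apply: smooth_mx_derivable (smooth_section.2 phi aphi) _.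
by split.
Qed.

End ShiftedSection.
End Sections.

(** * Vertical vectors *)

Section ParabolicCurves.
Context {R : realType}.
Local Notation C := R[i].

(** The difference quotients of a linear function are constant. Continuity is assumed separately
    since [V] is an arbitrary normed space. *)
Lemma smooth_linear (V : normedModType R) (F : V -> R) (U : set V) :
  continuous F -> (forall (h : R) v x, F (h *: v + x) = h * F v + F x) ->
  smooth_on U F.
Proof.
move=> cF lF.
have D x v : is_derive x v F (F v).
  have E : \forall h \near (0 : R)^', h^-1 *: (F (h *: v + x) - F x) = F v.
    near=> h; have h0 : h != 0 by near: h; exact: nbhs_dnbhs_neq.
    by rewrite lF addrK /GRing.scale/= mulKf.
  have L : h^-1 *: (F (h *: v + x) - F x) @[h --> (0 : R)^'] --> F v.
    apply: (@cvg_trans _ ((fun=> F v) @ (0 : R)^')); last exact: cvg_cst.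
    apply: near_eq_cvg.
    by apply: filterS E => h ->.
  have dF : derivable F x v.
    apply/cvg_ex; exists (F v). exact: L.
  refine (DeriveDef dF _).
  exact: cvg_lim.
have cF' x : U x -> {for x, continuous F} by move=> _; exact: cF.
case=> [|k]; first by split.
split=> // v; split; first by move=> x _; have [] := D x v.
have -> : 'D_v F = (fun=> F v) by apply/funext => x; have [_ ->] := D x v.
exact: ck_cst.
Unshelve. all: by end_near. Qed.

Definition unipotent_curve (i j : 'I_3) (l : C) (t : R) : 'M[C]_3 :=
  1%:M + (t%:C%C * l) *: delta_mx i j.

(** The matrix is triangular with unit diagonal, on the side decided by the order of [i] and [j]; as
    [j] is not 0, the first column is untouched. *)
Lemma unipotent_curve_parabolic i j l t : i != j -> j != ord0 ->
  parabolic (unipotent_curve i j l t).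
Proof.
move=> ij j0; split; last first.
  by move=> k; rewrite !mxE [ord0 == j]eq_sym (negPf j0) andbF /= mulr0 addr0.
have trig (a b : 'I_3) (c : C) : (b < a)%N -> \det (1%:M + c *: delta_mx a b : 'M[C]_3) = 1.
  move=> ba; rewrite det_trig.
    apply: big1 => k _; rewrite !mxE eqxx; case: eqP => [->|_]; last by rewrite mulr0 addr0.
    rewrite (_ : (a == b) = false) ?mulr0 ?addr0//.
    by apply/negbTE; rewrite neq_ltn ba orbT.
  apply/is_trig_mxP => r k rk; rewrite !mxE.
  have -> : (r == k) = false by apply/negbTE; rewrite neq_ltn rk.
  have -> : (r == a) && (k == b) = false.
    apply/negbTE/negP => /andP[/eqP ra /eqP kb].
    by move: rk; rewrite ra kb => /(ltn_trans ba); rewrite ltnn.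
  by rewrite mulr0 addr0.
case: (ltngtP j i) => [ji|ji|/val_inj E]; first exact: trig.
  by rewrite -det_tr /unipotent_curve linearD linearZ /= trmx1 trmx_delta trig.
by rewrite E eqxx in ij.
Qed.

(* The quadratic term keeps this scalar away from 0 for every [t]; its derivative at 0
   is [l]. *)
Definition torus_scalar (l : C) (t : R) : C :=
  Complex (1 + t * complex.Re l + t * t * (complex.Re l * complex.Re l)) (t * complex.Im l).

(** With r = Re l the real part equals (1/2 + t r)^2 + 3/4. *)
Lemma torus_scalar_neq0 l t : torus_scalar l t != 0.
Proof.
rewrite eq_complex negb_and /=; apply/orP; left; apply/eqP.
set r := complex.Re l; have : 0 <= (2^-1 + t * r) ^+ 2 by exact: sqr_ge0.
by move=> h1 h2; nra.
Qed.

(** For [j] different from 0, the inverse in position 0 keeps the determinant equal to 1. *)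
Definition torus_curve (j : 'I_3) (l : C) (t : R) : 'M[C]_3 :=
  diag_mx (\row_a (if a == j then torus_scalar l t
                   else if a == ord0 then (torus_scalar l t)^-1 else 1)).

Lemma torus_curve_parabolic j l t : j != ord0 -> parabolic (torus_curve j l t).
Proof.
move=> j0; split; last first.
  by move=> k; rewrite !mxE (_ : (up k == ord0) = false)// mulr0n.
rewrite /torus_curve det_diag (bigD1 j)//= (bigD1 ord0)/=; last by rewrite eq_sym.
rewrite !mxE !eqxx eq_sym (negPf j0) big1.
  by rewrite mulr1 mulfV// torus_scalar_neq0.
by move=> a /andP[aj a0]; rewrite mxE (negPf aj) (negPf a0).
Qed.

Section Smooth.
Variables (V : normedModType R) (U : set V) (tau : V -> R).
Hypotheses (oU : open U) (st : smooth_on U tau).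

Lemma csmooth_unipotent_curve i j l : smooth_cmx U (unipotent_curve i j l \o tau).
Proof.
move=> a b; change (csmooth U (fun x => unipotent_curve i j l (tau x) a b)).
have S : csmooth U (fun x => (1%:M : 'M[C]_3) a b + (tau x)%:C%C * (l * (delta_mx i j : 'M[C]_3) a b)).
  apply: csmoothD => //; first exact: csmooth_cst.
  by apply: csmoothM => //; [exact: csmooth_real|exact: csmooth_cst].
by apply: csmooth_eq S => // x _; rewrite !mxE mulrA.
Qed.

Lemma csmooth_torus_scalar l : csmooth U (fun x => torus_scalar l (tau x)).
Proof.
split; rewrite /=.
  apply: smoothD => //.
    apply: smoothD => //; first exact: smooth_cst.
    by apply: smoothM => //; exact: smooth_cst.
  by apply: smoothM => //; [exact: smoothM|exact: smooth_cst].
by apply: smoothM => //; exact: smooth_cst.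
Qed.

Lemma csmooth_torus_curve j l : smooth_cmx U (torus_curve j l \o tau).
Proof.
move=> a b; change (csmooth U (fun x => torus_curve j l (tau x) a b)).
rewrite /torus_curve; have [->|ab] := eqVneq a b; last first.
  by apply: csmooth_eq (csmooth_cst U 0) => // x _; rewrite !mxE (negPf ab).
have St := csmooth_torus_scalar l.
have [->|bj] := eqVneq b j.
  by apply: csmooth_eq St => // x _; rewrite !mxE !eqxx.
have [b0|b0] := eqVneq b ord0.
  rewrite b0 in bj *; have Sv := csmoothV oU (fun x _ => torus_scalar_neq0 l (tau x)) St.
  by apply: csmooth_eq Sv => // x _; rewrite !mxE !eqxx (negPf bj).
by apply: csmooth_eq (csmooth_cst U 1) => // x _; rewrite !mxE eqxx (negPf bj) (negPf b0).
Qed.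

End Smooth.
End ParabolicCurves.

Section CurveDerivatives.
Context {R : realType}.
Local Notation C := R[i].

Lemma smooth_id (U : set R) : smooth_on U (fun t : R => t).
Proof. by apply: smooth_linear => [x|//]; exact: cvg_id. Qed.

Lemma csmooth_torus_scalar_id l : csmooth [set: R] (torus_scalar l).
Proof. exact: (csmooth_torus_scalar openT (smooth_id setT) l). Qed.

Lemma is_Dc_id : is_Dc (0 : R) 1 (fun t : R => t%:C%C) (1 : C).
Proof. by split; [exact: is_derive_id|exact: is_derive_cst]. Qed.

Lemma Dcmx_unipotent_curve i j (l : C) :
  Dcmx (1 : R) (unipotent_curve i j l) 0 = l *: delta_mx i j.
Proof.
apply/matrixP => a b; rewrite !mxE; apply: is_DcE.
have -> : (fun t => unipotent_curve i j l t a b) =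
   (fun t => (1%:M : 'M[C]_3) a b + t%:C%C * (l * (delta_mx i j : 'M[C]_3) a b)).
  by apply/funext => t; rewrite !mxE mulrA.
have := is_DcD (is_Dc_cst (0 : R) 1 ((1%:M : 'M[C]_3) a b))
   (is_DcMr (l * (delta_mx i j : 'M[C]_3) a b) is_Dc_id).
by rewrite add0r mul1r !mxE.
Qed.

Lemma torus_scalar0 (l : C) : torus_scalar l 0 = 1.
Proof. by apply: complexP; rewrite /=; ring. Qed.

Lemma is_Dc_torus_scalar (l : C) : is_Dc (0 : R) 1 (torus_scalar l) l.
Proof.
have D := csmooth_is_Dc (1 : R) (csmooth_torus_scalar_id l) (I : [set: R] 0).
apply: is_Dc_eq D _.
apply: is_DcE; split => /=.
  have d1 : is_derive (0 : R) 1 (fun t : R =>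
      1 + t * complex.Re l + t * t * (complex.Re l * complex.Re l)) (complex.Re l).
    have dx : is_derive (0 : R) 1 (fun t : R => t) 1 by exact: is_derive_id.
    have dc a : is_derive (0 : R) 1 (fun=> a : R) 0 by exact: is_derive_cst.
    apply: is_derive_eq (is_deriveD (is_deriveD (dc 1) (is_deriveM dx (dc _)))
      (is_deriveM (is_deriveM dx dx) (dc _))) _.
    by rewrite /GRing.scale/= ; ring.
  exact: d1.
have dx : is_derive (0 : R) 1 (fun t : R => t) 1 by exact: is_derive_id.
apply: is_derive_eq (is_deriveM dx (is_derive_cst (complex.Im l) (0 : R) 1)) _.
by rewrite /GRing.scale/=; ring.
Qed.

(** The derivative comes from the product of the scalar and its inverse, which is constant. *)
Lemma is_Dc_torus_scalarV (l : C) : is_Dc (0 : R) 1 (fun t => (torus_scalar l t)^-1) (- l).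
Proof.
have S := csmoothV openT (fun t _ => torus_scalar_neq0 l t) (csmooth_torus_scalar_id l).
have D := csmooth_is_Dc (1 : R) S (I : [set: R] 0).
apply: is_Dc_eq D _.
move: (is_DcM (is_Dc_torus_scalar l) (csmooth_is_Dc (1 : R) S (I : [set: R] 0))).
rewrite (_ : (fun y => _) = fun=> 1); last first.
  by apply/funext => t; rewrite mulfV// torus_scalar_neq0.
move=> /is_DcE; rewrite (is_DcE (is_Dc_cst _ _ _)) torus_scalar0 invr1 mulr1 mul1r.
by move=> /esym/eqP; rewrite addrC addr_eq0 => /eqP.
Qed.

Lemma Dcmx_torus_curve j (l : C) : j != ord0 ->
  Dcmx (1 : R) (torus_curve j l) 0 = l *: (delta_mx j j - delta_mx ord0 ord0).
Proof.
move=> j0; apply/matrixP => a b; rewrite !mxE; apply: is_DcE; rewrite /torus_curve.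
have [->|ab] := eqVneq a b; last first.
  rewrite (_ : (fun y => _) = fun=> 0); last by apply/funext => t; rewrite !mxE (negPf ab).
  have nab (k : 'I_3) : (a == k) && (b == k) = false.
    by apply/negbTE/negP => /andP[/eqP ak /eqP bk]; rewrite ak bk eqxx in ab.
  by rewrite !nab subrr mulr0; exact: is_Dc_cst.
have [->|bj] := eqVneq b j.
  rewrite (_ : (fun y => _) = torus_scalar l); last by apply/funext => t; rewrite !mxE !eqxx.
  by rewrite (negPf j0) /= subr0 mulr1; exact: is_Dc_torus_scalar.
have [b0|b0] := eqVneq b ord0.
  rewrite b0 in bj *; rewrite (_ : (fun y => _) = fun t => (torus_scalar l t)^-1); last first.
    by apply/funext => t; rewrite !mxE !eqxx (negPf bj).
  by rewrite /= sub0r mulrN1; exact: is_Dc_torus_scalarV.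
rewrite (_ : (fun y => _) = fun=> 1); last first.
  by apply/funext => t; rewrite !mxE eqxx (negPf bj) (negPf b0).
by rewrite /= subrr mulr0; exact: is_Dc_cst.
Qed.

Lemma unipotent_curve0 i j (l : C) : unipotent_curve i j l (0 : R) = 1%:M.
Proof. by rewrite /unipotent_curve mul0r scale0r addr0. Qed.

Lemma torus_curve0 j (l : C) : torus_curve j l (0 : R) = 1%:M.
Proof.
apply/matrixP => a b; rewrite !mxE torus_scalar0 invr1.
by case: ifP => _; rewrite ?if_same.
Qed.

Lemma ord2_cases (k : 'I_2) : k = 0 \/ k = 1.
Proof. by case: k => [[|[|//]] h]; [left|right]; apply: val_inj. Qed.

(** Each summand is the velocity at 0 of a torus or unipotent curve; the trace condition fixes the
    entry at (0, 0). *)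
Lemma parabolic_lie_decomp (X : 'M[C]_3) : \tr X = 0 ->
  (forall k, X (up k) ord0 = 0) ->
  X = X (up 0) (up 0) *: (delta_mx (up 0) (up 0) - delta_mx ord0 ord0) +
      X (up 1) (up 1) *: (delta_mx (up 1) (up 1) - delta_mx ord0 ord0) +
      X ord0 (up 0) *: delta_mx ord0 (up 0) +
      X ord0 (up 1) *: delta_mx ord0 (up 1) +
      X (up 0) (up 1) *: delta_mx (up 0) (up 1) +
      X (up 1) (up 0) *: delta_mx (up 1) (up 0).
Proof.
move=> tX X0.
have X00 : X ord0 ord0 = - (X (up 0) (up 0) + X (up 1) (up 1)).
  apply/eqP; rewrite -addr_eq0 -tX /mxtrace big_ord_recl; apply/eqP; congr (_ + _).
  rewrite big_ord_recl big_ord1; congr (X _ _ + X _ _); exact: val_inj.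
apply/matrixP => a b; rewrite !mxE.
case: (unliftP ord0 a) => [i ->|->]; case: (unliftP ord0 b) => [k ->|->].
- by case: (ord2_cases i) => ->; case: (ord2_cases k) => -> /=; rewrite /up; ring.
- by case: (ord2_cases i) => ->; rewrite X0 /=; ring.
- by case: (ord2_cases k) => -> /=; rewrite /up; ring.
- by rewrite X00 /=; ring.
Qed.

End CurveDerivatives.

Section Vertical.
Context {R : realType} (M : complex_surface R) (B : principal_bundle M).
Local Notation C := R[i].
Variable theta : mxform B.
Hypothesis CC : cartan_connection theta.
Variables (phi : chart R 16 B) (z : chart R (2 + 2) M).
Hypotheses (aphi : atlas phi) (az : atlas z).

Definition proj_loc : 'rV[R]_16 -> 'rV[R]_(2 + 2) := fwd z \o @pb_proj R M B \o bwd phi.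

Definition proj_dom : set 'rV[R]_16 :=
  chart_image phi `&` (@pb_proj R M B \o bwd phi) @^-1` chart_dom z.

Lemma smooth_into_proj : smooth_into (chart_image phi) (@pb_proj R M B \o bwd phi).
Proof. by apply: smooth_into_map (pb_proj_smooth B) => // q _. Qed.

Lemma open_proj_dom : open proj_dom.
Proof. exact: smooth_into_open (atlas_open aphi) smooth_into_proj az. Qed.

Lemma smooth_proj_loc : smooth_mx proj_dom proj_loc.
Proof. exact: smooth_into_proj.2. Qed.

Variable b : B.
Hypotheses (dphi : chart_dom phi b) (dbz : chart_dom z (pb_proj b)).

Lemma proj_dom_fwd : proj_dom (fwd phi b).
Proof. by split; [exact: chart_fwd|rewrite /= chart_fwdK]. Qed.

(** A condition on values of theta rather than on vectors, because [cartan_fundamental] describes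
    the velocity of a curve by its value under theta. *)
Let vertical X := exists u, theta phi (fwd phi b) u = X /\ 'D_u proj_loc (fwd phi b) = 0.

(** The curve b c(t) stays in one fibre, so the projection is constant along it. Smoothness of [c]
    is asked along every [tau] because it is used both on R, for [cartan_fundamental], and on row
    vectors of length 1, for [pb_act_smooth]. *)
Lemma curve_vertical (c : R -> 'M[C]_3) :
  (forall (V : normedModType R) (U : set V) tau, open U -> smooth_on U tau ->
    smooth_cmx U (c \o tau)) ->
  (forall t, parabolic (c t)) -> c 0 = 1%:M -> vertical (Dcmx (1 : R) c 0).
Proof.
move=> sc pc c0.
pose gamma t := fwd phi (pb_act b (c t)).
exists ('D_1 gamma 0); split.
  apply: cartan_fundamental => //.
  have := sc R^o setT id openT (smooth_id setT).
  by [].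
pose f1 (x : 'rV[R]_1) := pb_act b (c (x 0 0)).
have s1 : smooth_into setT f1.
  apply: (@pb_act_smooth _ _ B 1 setT (fun=> b) (fun x => c (x 0 0))) => //.
  - exact: openT.
  - split; first by move=> x _; exact: cst_continuous.
    by move=> psi apsi i j; exact: smooth_cst.
  - apply: (sc _ setT (fun x : 'rV[R]_1 => x 0 0) openT).
    apply: smooth_linear => [|h v x]; first exact: coord_continuous.
    by rewrite !mxE.
have o1 := smooth_into_open openT s1 aphi.
pose l (t : R) : 'rV[R]_1 := t *: delta_mx 0 0.
have lE t : l t 0 0 = t by rewrite !mxE mulr1.
have dl : derivable l 0 1.
  apply/derivable_mxP => i j; rewrite !(ord1 i) !(ord1 j).
  rewrite (_ : (fun x => _) = id); last by apply/funext => t; rewrite lE.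
  exact: derivable_id.
have gE : gamma = (fwd phi \o f1) \o l by apply/funext => t; rewrite /= /f1 lE.
have f10 : f1 (l 0) = b by rewrite /f1 lE c0 pb_act1.
have in1 : (setT `&` f1 @^-1` chart_dom phi) (l 0) by split => //=; rewrite f10.
have [_ dg] := smooth_mx_chain o1 (s1.2 phi aphi) in1 dl.
rewrite -gE in dg.
have g0 : gamma 0 = fwd phi b by rewrite gE /= f10.
have in2 : proj_dom (gamma 0) by rewrite g0; exact: proj_dom_fwd.
have [+ _] := smooth_mx_chain open_proj_dom smooth_proj_loc in2 dg.
rewrite g0 => <-.
rewrite (near_eq_derive (g := fun=> fwd z (pb_proj b))); first exact: derive_cst.
have lc : {for 0, continuous l}.
  by apply/differentiable_continuous/derivable1_diffP.
have n1 : nbhs (l 0) (setT `&` f1 @^-1` chart_dom phi) by exact: open_nbhs_nbhs.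
have n0 : nbhs (0 : R) (l @^-1` (setT `&` f1 @^-1` chart_dom phi)) by exact: lc.
apply: filterS n0 => t [_ /=]; rewrite /f1 lE => dt.
rewrite /proj_loc /= /gamma chart_fwdK//; congr (fwd z _); apply/esym/pb_fibre.
by exists (c t).
Qed.

Lemma vertical_add X Y : vertical X -> vertical Y -> vertical (X + Y).
Proof.
move=> [u [<- Du]] [v [<- Dv]]; exists (u + v); split.
  by have := cartan_linear CC 1 u v aphi (chart_fwd dphi); rewrite !scale1r.
have in0 := proj_dom_fwd.
apply/rowP => a; rewrite (smooth_mx_deriveE _ _ smooth_proj_loc in0) mxE.
rewrite (deriveDv _ _ open_proj_dom in0 (smooth_proj_loc 0 a 1%N)).
rewrite -!(smooth_mx_deriveE _ _ smooth_proj_loc in0).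
by rewrite Du Dv !mxE addr0.
Qed.

Lemma vertical_unipotent i j l : i != j -> j != ord0 -> vertical (l *: delta_mx i j).
Proof.
move=> ij j0; rewrite -Dcmx_unipotent_curve; apply: curve_vertical.
- by move=> V U tau oU st; exact: csmooth_unipotent_curve.
- by move=> t; exact: unipotent_curve_parabolic.
- exact: unipotent_curve0.
Qed.

Lemma vertical_torus j l : j != ord0 ->
  vertical (l *: (delta_mx j j - delta_mx ord0 ord0)).
Proof.
move=> j0; rewrite -Dcmx_torus_curve//; apply: curve_vertical.
- by move=> V U tau oU st; exact: csmooth_torus_curve.
- by move=> t; exact: torus_curve_parabolic.
- exact: torus_curve0.
Qed.

(** The value of theta on [u] lies in Lie(P), hence is also its value on a vector killed by the
    projection; injectivity of theta identifies the two vectors. *)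
Lemma theta_vertical u :
  (forall i, theta phi (fwd phi b) u (up i) ord0 = 0) ->
  'D_u proj_loc (fwd phi b) = 0.
Proof.
move=> th0; have Ib : chart_image phi (fwd phi b) by exact: chart_fwd.
have tr0 := cartan_trace CC u aphi Ib.
have [v [vE Dv]] : vertical (theta phi (fwd phi b) u).
  rewrite (parabolic_lie_decomp tr0 th0).
  do 4![apply: vertical_add; last exact: vertical_unipotent].
  by apply: vertical_add; exact: vertical_torus.
have [w [_ wu]] := cartan_iso CC aphi Ib tr0.
by rewrite -(wu u erefl) (wu v vE) Dv.
Qed.

End Vertical.

(** * The Weyl curvature in an adapted frame *)

Section ParabolicBlocks.
Context {R : realType}.
Local Notation C := R[i].
Variable p : 'M[C]_3.
Hypothesis pp : parabolic p.

Definition levi (q : 'M[C]_3) : 'M[C]_2 := \matrix_(i, j) q (up i) (up j).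

Lemma sum_up (F : 'I_3 -> C) : \sum_a F a = F ord0 + \sum_k F (up k).
Proof. exact: big_ord_recl. Qed.

Lemma parabolic_unit : p \in unitmx.
Proof. by rewrite unitmxE; case: pp => -> _; exact: unitr1. Qed.

Lemma parabolic_entry : invmx p ord0 ord0 * p ord0 ord0 = 1.
Proof.
have /matrixP/(_ ord0 ord0) := mulVmx parabolic_unit; rewrite !mxE sum_up big1.
  by rewrite addr0 eqxx.
by move=> k _; case: pp => _ ->; rewrite mulr0.
Qed.

Lemma parabolic_entry_neq0 : p ord0 ord0 != 0.
Proof.
apply/eqP => p0; have := parabolic_entry; rewrite p0 mulr0 => /eqP.
by rewrite eq_sym oner_eq0.
Qed.

Lemma invmx_parabolic i : invmx p (up i) ord0 = 0.
Proof.
have /matrixP/(_ (up i) ord0) := mulVmx parabolic_unit; rewrite !mxE sum_up big1.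
  by rewrite addr0 => /eqP; rewrite mulf_eq0 (negPf parabolic_entry_neq0) orbF => /eqP.
by move=> k _; case: pp => _ ->; rewrite mulr0.
Qed.

Lemma levi_inv : levi (invmx p) *m levi p = 1%:M.
Proof.
apply/matrixP => i j; have /matrixP/(_ (up i) (up j)) := mulVmx parabolic_unit.
rewrite !mxE sum_up invmx_parabolic mul0r add0r (inj_eq lift_inj) => <-.
by apply: eq_bigr => k _; rewrite !mxE.
Qed.

Lemma conj_parabolic_up0 (A : 'M[C]_3) l : A ord0 ord0 = 0 ->
  (invmx p *m A *m p) (up l) ord0 =
  \sum_m (p ord0 ord0 *: levi (invmx p)) l m * A (up m) ord0.
Proof.
move=> A0; rewrite mxE sum_up [X in _ + X]big1 => [|k _]; last first.
  by case: pp => _ ->; rewrite mulr0.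
rewrite addr0 mxE sum_up invmx_parabolic mul0r add0r mulr_suml.
by apply: eq_bigr => m _; rewrite !mxE; ring.
Qed.

Lemma conj_parabolic_upup (A : 'M[C]_3) i k :
  (invmx p *m A *m p) (up i) (up k) =
  \sum_m levi (invmx p) i m *
    (A (up m) ord0 * p ord0 (up k) + \sum_n A (up m) (up n) * levi p n k).
Proof.
rewrite -mulmxA mxE sum_up invmx_parabolic mul0r add0r.
apply: eq_bigr => m _; rewrite !mxE; congr (_ * _); rewrite sum_up.
by congr (_ + _); apply: eq_bigr => n _; rewrite mxE.
Qed.

(** The adjoint action of [p] on the quotient of the Lie algebra by Lie(P), which models the tangent
    plane of [M]. A scalar factor of [p] cancels, so only the class of [p] in P matters. *)
Definition frame : 'M[C]_2 := (p ord0 ord0)^-1 *: levi p.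
Definition coframe : 'M[C]_2 := p ord0 ord0 *: levi (invmx p).

Lemma coframeK : coframe *m frame = 1%:M.
Proof.
rewrite /coframe /frame -scalemxAl -scalemxAr levi_inv scalerA mulfV ?scale1r//.
exact: parabolic_entry_neq0.
Qed.

Lemma frameK : frame *m coframe = 1%:M.
Proof. exact: (mulmx1C coframeK). Qed.

End ParabolicBlocks.

Lemma sum_wirtinger (R : realType) (c : 'I_2 -> R[i]) (d1 d2 : 'I_2 -> 'I_2 -> R[i])
    (q : 'I_2 -> R[i]) (w : R[i]) :
  (\sum_m c m * (\sum_n d1 m n * q n) + w * \sum_m c m * (\sum_n d2 m n * q n)) / 2%:R =
  \sum_m \sum_n c m * ((d1 m n + w * d2 m n) / 2%:R) * q n.
Proof.
rewrite mulr_sumr -big_split mulr_suml; apply: eq_bigr => m _ /=.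
rewrite !mulr_sumr -big_split mulr_suml; apply: eq_bigr => n _ /=.
by move: (d1 m n) (d2 m n) => *; ring.
Qed.

Lemma sum2_comb (R : realType) (w a1 a2 a3 a4 : 'I_2 -> 'I_2 -> R[i]) (c : R[i]) :
  \sum_l \sum_j w l j * a1 l j + c * (\sum_l \sum_j w l j * a2 l j) -
  c * (\sum_l \sum_j w l j * a3 l j) + \sum_l \sum_j w l j * a4 l j =
  \sum_l \sum_j w l j * (a1 l j + c * a2 l j - c * a3 l j + a4 l j).
Proof.
rewrite !mulr_sumr -sumrN -!big_split; apply: eq_bigr => l _ /=.
rewrite !mulr_sumr -sumrN -!big_split; apply: eq_bigr => j _ /=; ring.
Qed.

Section AdaptedFrame.
Context {R : realType} (M : complex_surface R) (B : principal_bundle M).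
Local Notation C := R[i].
Local Notation ii := (Complex 0 1 : C).
Local Notation vect := 'rV[R]_(2 + 2).
Variable theta : mxform B.
Hypothesis CC : cartan_connection theta.
Variables (nabla : connection M) (z : chart R (2 + 2) M) (s : M -> B).
Hypotheses (CL : complex_linear nabla) (az : atlas z).
Hypothesis adapted : adapted_section theta nabla z s.
Variable p : 'M[C]_3.
Hypothesis pp : parabolic p.
Let U := chart_image z.
Let oU : open U := atlas_open az.
Let ss : smooth_map (chart_dom z) s. Proof. by case: adapted. Qed.
Let sK : forall y, chart_dom z y -> pb_proj (s y) = y. Proof. by case: adapted. Qed.
Let sp := shifted_section z s p.

Definition adapted_form (x w : vect) : 'M[C]_3 :=
  \matrix_(a, b) match unlift ord0 a, unlift ord0 b with
    | None, None => 0
    | Some i, None => dz i w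
    | None, Some i => \sum_k Pi2 nabla z i k x * dz k w
    | Some i, Some j => \sum_k Pi3 nabla z i j k x * dz k w
    end.

Lemma adapted_formE x w phi : U x -> atlas phi -> chart_dom phi (s (bwd z x)) ->
  theta phi (fwd phi (s (bwd z x))) ('D_w (fwd phi \o s \o bwd z) x) = adapted_form x w.
Proof.
move=> Ux aphi dphi; case: adapted => _ _ /(_ x phi Ux aphi dphi w) [a00 ai0 aij a0i].
apply/matrixP => a b; rewrite mxE.
by case: (unliftP ord0 a) => [i ->|->]; case: (unliftP ord0 b) => [k ->|->].
Qed.

(** The pulled-back form has type (1,0), which keeps its wedge square out of the (1,1)-part of the
    structure equation. *)
Lemma adapted_form_J x w : adapted_form x (Jv w) = ii *: adapted_form x w.
Proof.
apply/matrixP => a b; rewrite !mxE.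
case: (unlift ord0 a) => [i|]; case: (unlift ord0 b) => [k|]; rewrite ?dz_J ?mulr0//;
  by rewrite mulr_sumr; apply: eq_bigr => l _; rewrite dz_J mulrCA.
Qed.

Lemma shifted_formE x w psi : U x -> atlas psi -> chart_dom psi (sp x) ->
  theta psi (fwd psi (sp x)) ('D_w (fwd psi \o sp) x) =
  invmx p *m adapted_form x w *m p.
Proof.
move=> Ux apsi dpsi; have [phi aphi dphi] := atlas_cover (s (bwd z x)).
by rewrite (section_equivariant CC az ss pp w Ux aphi apsi dphi dpsi) adapted_formE.
Qed.

Let adapted_form00 x w : adapted_form x w ord0 ord0 = 0.
Proof. by rewrite mxE unlift_none. Qed.
Let adapted_form10 x w m : adapted_form x w (up m) ord0 = dz m w.
Proof. by rewrite mxE liftK unlift_none. Qed.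
Let adapted_form11 x w m n : adapted_form x w (up m) (up n) = \sum_k Pi3 nabla z m n k x * dz k w.
Proof. by rewrite mxE !liftK. Qed.

Lemma shifted_form_up0 x w l :
  (invmx p *m adapted_form x w *m p) (up l) ord0 = \sum_m coframe p l m * dz m w.
Proof.
by rewrite conj_parabolic_up0//; apply: eq_bigr => m _; rewrite adapted_form10.
Qed.

Let sform i k w x := (invmx p *m adapted_form x w *m p) (up i) (up k).

Lemma csmooth_shifted_form i k w : csmooth U (sform i k w).
Proof.
have S : csmooth U (fun x => \sum_m levi (invmx p) i m *
    (dz m w * p ord0 (up k) + \sum_n (\sum_l Pi3 nabla z m n l x * dz l w) * levi p n k)).
  apply: csmooth_sum => // m; apply: csmoothM => //; first exact: csmooth_cst.
  apply: csmoothD => //; first exact: csmooth_cst.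
  apply: csmooth_sum => // n; apply: csmoothM => //; last exact: csmooth_cst.
  apply: csmooth_sum => // l; apply: csmoothM => //; last exact: csmooth_cst.
  exact: csmooth_Pi3.
apply: csmooth_eq S => // x _; rewrite /sform conj_parabolic_upup//.
apply: eq_bigr => m _; rewrite adapted_form10; congr (_ * (_ + _)).
by apply: eq_bigr => n _; rewrite adapted_form11.
Qed.

Lemma Dc_shifted_form_J i k w u x : U x ->
  Dc u (sform i k (Jv w)) x = ii * Dc u (sform i k w) x.
Proof.
move=> Ux; apply: is_DcE.
have -> : sform i k (Jv w) = fun x => ii * sform i k w x.
  by apply/funext => y; rewrite /sform adapted_form_J -scalemxAr -scalemxAl mxE.
by apply: is_DcMl; exact: csmooth_is_Dc (csmooth_shifted_form i k w) Ux.
Qed.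

(** On the constant field [ez r] the contribution of theta^i_0 is constant in the chart, so only the
    symbols [Pi3] are differentiated. *)
Lemma Dzb_shifted_form i k r t x : U x -> Dzb t (sform i k (ez r)) x =
  \sum_m \sum_n levi (invmx p) i m * Dzb t (Pi3 nabla z m n r) x * levi p n k.
Proof.
move=> Ux.
have E y : sform i k (ez r) y = \sum_m levi (invmx p) i m *
    (dz m (ez r) * p ord0 (up k) + \sum_n Pi3 nabla z m n r y * levi p n k).
  rewrite /sform conj_parabolic_upup//; apply: eq_bigr => m _.
  rewrite adapted_form10; congr (_ * (_ + _)); apply: eq_bigr => n _.
  rewrite adapted_form11 (bigD1 r)//= big1 => [|l lr].
    by rewrite dz_ez eqxx mulr1 addr0.
  by rewrite dz_ez (negPf lr) mulr0.
have D u : Dc u (sform i k (ez r)) x = \sum_m levi (invmx p) i m *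
    (\sum_n Dc u (Pi3 nabla z m n r) x * levi p n k).
  apply: is_DcE; rewrite (_ : sform i k (ez r) = fun y => \sum_m levi (invmx p) i m *
    (dz m (ez r) * p ord0 (up k) + \sum_n Pi3 nabla z m n r y * levi p n k)).
    apply: is_Dc_sum => m; apply: is_DcMl; rewrite -[X in is_Dc _ _ _ X]add0r.
    apply: is_DcD; first exact: is_Dc_cst.
    apply: is_Dc_sum => n; apply: is_DcMr.
    exact: csmooth_is_Dc (csmooth_Pi3 CL az m n r) Ux.
  by apply/funext => y; exact: E.
rewrite {1}/Dzb (D (ez t)) (D (Jv (ez t))).
exact: (sum_wirtinger _ (fun m n => Dc (ez t) (Pi3 nabla z m n r) x)).
Qed.

Variable b : B.
Hypotheses (zb : chart_dom z (pb_proj b)) (bE : b = pb_act (s (pb_proj b)) p).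
Let x := fwd z (pb_proj b).

Lemma shifted_section_base : sp x = b.
Proof. by rewrite /sp /shifted_section /x chart_fwdK. Qed.

Let Ux : U x. Proof. exact: chart_fwd. Qed.

(** The structure equation pulled back by the shifted section: [pullback_d] treats the exterior
    derivative, and the product term is pulled back pointwise. *)
Lemma pulled_curvature psi u v i k : atlas psi -> chart_dom psi b ->
  curvature theta psi (fwd psi b) ('D_u (fwd psi \o sp) x) ('D_v (fwd psi \o sp) x)
    (up i) (up k) =
  Dc u (sform i k v) x - Dc v (sform i k u) x +
  (invmx p *m adapted_form x u *m p *m (invmx p *m adapted_form x v *m p) -
   invmx p *m adapted_form x v *m p *m (invmx p *m adapted_form x u *m p)) (up i) (up k).
Proof.
move=> apsi dpsi; have spx := shifted_section_base.
pose F := fwd psi \o sp; pose O := U `&` sp @^-1` chart_dom psi.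
have si := smooth_shifted_section az ss pp.
have oO : open O by exact: smooth_into_open oU si apsi.
have Ox : O x by split=> //; rewrite /= spx.
have sF : smooth_mx O F by exact: si.2.
have FO y : O y -> chart_image psi (F y) by move=> [_ dy]; exact: chart_fwd.
have Fx : F x = fwd psi b by rewrite /F /= spx.
have FE w : theta psi (fwd psi b) ('D_w F x) = invmx p *m adapted_form x w *m p.
  by rewrite -Fx; apply: shifted_formE => //; rewrite spx.
have [sth lth] := (cartan_smooth CC, cartan_linear CC).
have D := @pullback_d _ _ _ O (chart_image psi) F
  (fun y w => theta psi y w (up i) (up k)) x u v oO (atlas_open apsi) sF FO.
have {}D := D (fun w => sth psi w apsi (up i) (up k)) _ Ox.
have E w w' : Dc w (fun y => theta psi (F y) ('D_w' F y) (up i) (up k)) x =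
    Dc w (sform i k w') x.
  apply: Dc_near; apply: (near_eq_open oO) Ox => y; rewrite inE => -[Uy dy].
  by rewrite [F y]/= shifted_formE.
rewrite -[X in X - _ + _]E -[X in _ - X + _]E D.
  by rewrite Fx -!FE /curvature mxE; congr (_ + _); rewrite !mxE.
move=> y a w1 w2 Iy; rewrite (lth psi y a w1 w2 apsi Iy) [LHS]mxE.
by congr (_ + _); rewrite mxE.
Qed.

Lemma theta_shifted_up0 psi w l : atlas psi -> chart_dom psi b ->
  theta psi (fwd psi b) ('D_w (fwd psi \o sp) x) (up l) ord0 =
  \sum_m coframe p l m * dz m w.
Proof.
move=> apsi dpsi; rewrite -(shifted_form_up0 x) -[in LHS]shifted_section_base.
by rewrite shifted_formE// shifted_section_base.
Qed.

(** Both expressions of the curvature are evaluated on d_r = (e - i Je)/2 and d_tbar = (f + i Jf)/2,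
    where the forms theta^l_0 take the coframe entries as values. The outcome is the transformation
    law required by [weyl_system_frame]. *)
Lemma weyl_shifted (L : B -> 'I_2 -> C) (K : B -> 'I_2 -> 'I_2 -> 'I_2 -> C)
    (W : B -> 'I_2 -> 'I_2 -> 'I_2 -> 'I_2 -> C) i k r t :
  curvature_functions theta L K W ->
  \sum_l \sum_j W b i k l j * coframe p l r * conjc (coframe p j t) =
  \sum_m \sum_n coframe p i m * (- Dzb t (Pi3 nabla z m n r) x) * frame p n k.
Proof.
move=> hW; have [psi apsi dpsi] := atlas_cover b.
pose tau l w : C := \sum_m coframe p l m * dz m w.
have tau_J l w : tau l (Jv w) = ii * tau l w.
  by rewrite /tau mulr_sumr; apply: eq_bigr => m _; rewrite dz_J mulrCA.
have tau_ez l m : tau l (ez m) = coframe p l m.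
  rewrite /tau (bigD1 m)//= big1 => [|m' mm]; first by rewrite dz_ez eqxx mulr1 addr0.
  by rewrite dz_ez (negPf mm) mulr0.
pose Q u v := curvature theta psi (fwd psi b) ('D_u (fwd psi \o sp) x)
  ('D_v (fwd psi \o sp) x) (up i) (up k).
have QW u v : Q u v = \sum_l \sum_j W b i k l j *
    (tau l u * conjc (tau j v) - tau l v * conjc (tau j u)).
  have [_ _ _ /(_ i k) E] :=
    curv_eq hW ('D_u (fwd psi \o sp) x) ('D_v (fwd psi \o sp) x) apsi dpsi.
  apply: etrans E _; apply: eq_bigr => l _; apply: eq_bigr => j _.
  by rewrite /wedge2 !(theta_shifted_up0 _ _ apsi dpsi).
pose q u v := (invmx p *m adapted_form x u *m p *m (invmx p *m adapted_form x v *m p))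
    (up i) (up k).
have q_Jl u v : q (Jv u) v = ii * q u v.
  by rewrite /q adapted_form_J -scalemxAr -!scalemxAl mxE.
have q_Jr u v : q u (Jv v) = ii * q u v.
  by rewrite /q adapted_form_J -scalemxAr -!scalemxAl -scalemxAr mxE.
pose d u v := Dc u (sform i k v) x.
have d_J u v : d u (Jv v) = ii * d u v by exact: Dc_shifted_form_J.
have QD u v : Q u v = d u v - d v u + (q u v - q v u).
  by rewrite /Q pulled_curvature// mxE [X in _ + (_ + X)]mxE.
pose e : vect := ez r; pose f : vect := ez t.
(* [4 Q (d_r, d_tbar)], computed with either side of the structure equation. *)
have ev_d : Q e f + ii * Q e (Jv f) - ii * Q (Jv e) f + Q (Jv e) (Jv f) =
    - (2%:R * (d f e + ii * d (Jv f) e)).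
  rewrite !QD !d_J !q_Jl !q_Jr.
  move: (d e f) (d f e) (d (Jv f) e) (d (Jv e) f) (q e f) (q f e) => a1 a2 a3 a4 b1 b2.
  (* Complex linearity of the form in its argument cancels everything except the d_tbar-derivative
     of its value on d_r. *)
  transitivity ((1 + ii * ii) * (a1 + a2 + b1 - b2) - 2%:R * (a2 + ii * a3)); first by ring.
  by rewrite iiM subrr mul0r add0r.
have ev_W : Q e f + ii * Q e (Jv f) - ii * Q (Jv e) f + Q (Jv e) (Jv f) =
    4%:R * \sum_l \sum_j W b i k l j * coframe p l r * conjc (coframe p j t).
  rewrite !QW sum2_comb mulr_sumr; apply: eq_bigr => l _.
  rewrite mulr_sumr; apply: eq_bigr => j _; rewrite !tau_J !tau_ez !conjcM conjc_ii.
  move: (W b i k l j) (coframe p l r) (conjc (coframe p j t)) (coframe p l t).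
  move: (conjc (coframe p j r)) => g w a b' c.
  transitivity (w * (4%:R * (a * b') + (1 + ii * ii) * (- (3%:R * (a * b')) - c * g))).
    by ring.
  by rewrite iiM subrr mul0r addr0; ring.
have four : 4%:R != 0 :> C by rewrite pnatr_eq0.
apply: (mulfI four); rewrite -ev_W ev_d.
have -> : \sum_m \sum_n coframe p i m * - Dzb t (Pi3 nabla z m n r) x * frame p n k =
   - Dzb t (sform i k (ez r)) x.
  rewrite Dzb_shifted_form// -sumrN; apply: eq_bigr => m _; rewrite -sumrN.
  apply: eq_bigr => n _; rewrite !mxE.
  have p0 := parabolic_entry_neq0 pp.
  move: (Dzb t _ x) => D.
  (* A factor p_00 / p_00 turns the two Levi blocks into coframe and frame. *)
  rewrite -[RHS](mulr1) -(mulfV p0); move: (_^-1) => ip; ring.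
rewrite -[Dzb t _ x]/((d f e + ii * d (Jv f) e) / 2%:R).
move: (d f e + _) => a; rewrite !mulrN; congr (- _).
by field.
Qed.

End AdaptedFrame.

(** * The soldering form and the projection to [M] *)

Section Soldering.
Context {R : realType} (M : complex_surface R) (B : principal_bundle M).
Local Notation C := R[i].
Local Notation vect := 'rV[R]_(2 + 2).
Variable theta : mxform B.
Hypothesis CC : cartan_connection theta.

Lemma proj_loc_deriveD phi z b u v : atlas phi -> atlas z ->
  chart_dom phi b -> chart_dom z (pb_proj b) ->
  'D_(u + v) (proj_loc (B := B) phi z) (fwd phi b) =
  'D_u (proj_loc (B := B) phi z) (fwd phi b) + 'D_v (proj_loc (B := B) phi z) (fwd phi b).
Proof.
move=> aphi az dphi dz; have in0 := proj_dom_fwd aphi dphi dz.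
have sP := smooth_proj_loc aphi az; have oP := open_proj_dom aphi az.
apply/rowP => a; rewrite mxE !(smooth_mx_deriveE _ _ sP in0).
exact: deriveDv oP in0 (sP 0 a 1%N).
Qed.

(** The chart vector [w] is chosen so that its image [u'] under the shifted section has the same
    theta^i_0 as [u]. Then u - u' is vertical, and [u'] projects back to [w] because the section is
    inverse to the projection. *)
Lemma soldering nabla z s p b phi u m : atlas z -> adapted_section theta nabla z s ->
  parabolic p -> chart_dom z (pb_proj b) -> b = pb_act (s (pb_proj b)) p ->
  atlas phi -> chart_dom phi b ->
  dz m ('D_u (proj_loc (B := B) phi z) (fwd phi b)) =
  \sum_k frame p m k * theta phi (fwd phi b) u (up k) ord0.
Proof.
move=> az ad pp dzb bE aphi dphi.
have [ss sK _] := ad.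
pose w := cvec (fun m => \sum_k frame p m k * theta phi (fwd phi b) u (up k) ord0).
pose sp := shifted_section z s p; pose x := fwd z (pb_proj b).
have spx : sp x = b by exact: shifted_section_base.
pose u' := 'D_w (fwd phi \o sp) x.
have Ib : chart_image phi (fwd phi b) by exact: chart_fwd.
have th l : theta phi (fwd phi b) u' (up l) ord0 = theta phi (fwd phi b) u (up l) ord0.
  rewrite (theta_shifted_up0 CC az ad pp dzb bE w l aphi dphi).
  have /matrixP E := coframeK pp.
  rewrite -[RHS]mul1r; under eq_bigr do rewrite dz_cvec mulr_sumr.
  rewrite exchange_big /= (bigD1 l)//= [X in _ + X]big1 => [|k kl].
    rewrite addr0.
    transitivity ((\sum_m' coframe p l m' * frame p m' l) * theta phi (fwd phi b) u (up l) ord0).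
      by rewrite mulr_suml; apply: eq_bigr => m' _; rewrite mulrA.
    by have := E l l; rewrite !mxE eqxx => ->.
  transitivity ((\sum_m' coframe p l m' * frame p m' k) * theta phi (fwd phi b) u (up k) ord0).
    by rewrite mulr_suml; apply: eq_bigr => m' _; rewrite mulrA.
  by have := E l k; rewrite !mxE eq_sym (negPf kl) => ->; rewrite mul0r.
have V0 : 'D_(u - u') (proj_loc (B := B) phi z) (fwd phi b) = 0.
  apply: (theta_vertical CC aphi az dphi dzb) => l.
  have -> : u - u' = (-1) *: u' + u by rewrite scaleN1r addrC.
  rewrite (cartan_linear CC (-1) u' u aphi Ib) mxE mxE th.
  by rewrite rmorphN1 mulN1r addNr.
have -> : u = (u - u') + u' by rewrite subrK.
rewrite proj_loc_deriveD// V0 add0r.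
have oU := atlas_open az.
have Ux : chart_image z x by exact: chart_fwd.
have si := smooth_shifted_section az ss pp.
have oO := smooth_into_open oU si aphi.
have Ox : (chart_image z `&` sp @^-1` chart_dom phi) x by split=> //=; rewrite spx.
have sF := si.2 phi aphi.
have in0 := proj_dom_fwd aphi dphi dzb.
have Fx : (fwd phi \o sp) x = fwd phi b by rewrite /= spx.
have [||+ _] := smooth_mx_chain (open_proj_dom aphi az) (smooth_proj_loc aphi az)
  (f := fwd phi \o sp) (x := x) (v := w); first by rewrite Fx.
  exact: smooth_mx_derivable sF Ox.
rewrite Fx -/u' => <-.
rewrite (near_eq_derive (g := id)); last first.
  apply: (near_eq_open oO) Ox => y; rewrite inE => -[Uy dy].
  rewrite /proj_loc /= chart_fwdK// (proj_shifted_section az sK pp Uy).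
  by have [_ ->] := chart_bwd az Uy.
by rewrite derive_id dz_cvec subrK.
Qed.

End Soldering.

Lemma bilinear_change (R : realType) (H : 'I_2 -> 'I_2 -> R[i]) (E : 'M[R[i]]_2)
    (t u : 'I_2 -> R[i]) :
  \sum_a \sum_c H a c * (\sum_i E a i * t i) * conjc (\sum_j E c j * u j) =
  \sum_i \sum_j (\matrix_(i, j) \sum_a \sum_c H a c * E a i * conjc (E c j)) i j *
    t i * conjc (u j).
Proof.
transitivity (\sum_a \sum_c \sum_i \sum_j
    H a c * E a i * conjc (E c j) * t i * conjc (u j)).
  apply: eq_bigr => a _; apply: eq_bigr => c _.
  rewrite conjc_sum mulr_sumr mulr_suml; apply: eq_bigr => i _.
  rewrite mulr_sumr; apply: eq_bigr => j _; rewrite conjcM.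
  by move: (H a c) (E a i) (t i) (conjc (E c j)) (conjc (u j)) => *; ring.
rewrite sum4_rot exchange_big /=; apply: eq_bigr => i _; apply: eq_bigr => j _.
rewrite mxE !mulr_suml; apply: eq_bigr => a _; rewrite !mulr_suml.
by apply: eq_bigr => c _.
Qed.

(** * The metric on the Cartan bundle *)

Section PulledBackMetric.
Context {R : realType} (M : complex_surface R) (B : principal_bundle M).
Local Notation C := R[i].
Local Notation cc := (@conjc R).
Local Notation vect := 'rV[R]_(2 + 2).
Variable theta : mxform B.
Hypothesis CC : cartan_connection theta.
Variables (g : kahler_metric M).

(** A characterisation instead of a formula: it mentions neither a section nor a group element, so
    it fixes [m] independently of the choices behind [frame_metric]. *)
Definition represents_metric b (m : 'M[C]_2) : Prop :=
  forall phi z u v, atlas phi -> atlas z -> chart_dom phi b -> chart_dom z (pb_proj b) ->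
  hform (metric g z (fwd z (pb_proj b)))
    ('D_u (proj_loc (B := B) phi z) (fwd phi b)) ('D_v (proj_loc (B := B) phi z) (fwd phi b)) =
  \sum_i \sum_j m i j * theta phi (fwd phi b) u (up i) ord0 *
    cc (theta phi (fwd phi b) v (up j) ord0).

(** theta maps onto the trace-free matrices, and the matrix unit at ([up k], 0) is one of them. *)
Lemma dual_vector b phi k : atlas phi -> chart_dom phi b -> exists u,
  forall i, theta phi (fwd phi b) u (up i) ord0 = (i == k)%:R.
Proof.
move=> aphi dphi.
have tr0 : \tr (delta_mx (up k) ord0 : 'M[C]_3) = 0.
  rewrite /mxtrace big1// => a _; rewrite mxE.
  by case: eqP => // -> /=.
have [u [uE _]] := cartan_iso CC aphi (chart_fwd dphi) tr0.
by exists u => i; rewrite uE mxE eqxx andbT (inj_eq lift_inj).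
Qed.

Lemma represents_metric_unique b m m' :
  represents_metric b m -> represents_metric b m' -> m = m'.
Proof.
move=> hm hm'; apply/matrixP => i j.
have [phi aphi dphi] := atlas_cover b.
have [z az dzb] := atlas_cover (pb_proj b).
have [u uE] := dual_vector i aphi dphi; have [v vE] := dual_vector j aphi dphi.
have E (n : 'M[C]_2) : \sum_i' \sum_j' n i' j' * theta phi (fwd phi b) u (up i') ord0 *
    cc (theta phi (fwd phi b) v (up j') ord0) = n i j.
  rewrite (bigD1 i)//= [X in _ + X]big1 => [|a ai]; last first.
    by apply: big1 => a' _; rewrite uE (negPf ai) mulr0 mul0r.
  rewrite addr0 (bigD1 j)//= big1 => [|a aj].
    by rewrite uE vE !eqxx conjc1 !mulr1 addr0.
  by rewrite vE (negPf aj) conjc0 mulr0.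
by rewrite -E -(hm phi z u v) // (hm' phi z u v)// E.
Qed.

(** The metric axiom gives the real part; for the imaginary part the transition map must commute
    with J, which is its holomorphy. *)
Lemma hform_transition phi z z' b u v : atlas phi -> atlas z -> atlas z' ->
  chart_dom phi b -> chart_dom z (pb_proj b) -> chart_dom z' (pb_proj b) ->
  hform (metric g z' (fwd z' (pb_proj b)))
    ('D_u (proj_loc (B := B) phi z') (fwd phi b)) ('D_v (proj_loc (B := B) phi z') (fwd phi b)) =
  hform (metric g z (fwd z (pb_proj b)))
    ('D_u (proj_loc (B := B) phi z) (fwd phi b)) ('D_v (proj_loc (B := B) phi z) (fwd phi b)).
Proof.
move=> aphi az az' dphi dz dz'.
pose x := fwd z (pb_proj b); pose T := transition z z'.
have ox : overlap z z' x by exists (pb_proj b).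
have oo : open (overlap z z').
  have -> : overlap z z' = chart_image z `&` bwd z @^-1` chart_dom z'.
    rewrite eqEsubset; split => y.
      by move=> [q [dq dq'] <-]; split; [exact: chart_fwd|rewrite /= chart_fwdK].
    by move=> [Iy dy]; have [d1 E] := chart_bwd az Iy; exists (bwd z y).
  exact: smooth_into_open (atlas_open az) (smooth_into_bwd az) az'.
have sT : smooth_mx (overlap z z') T by exact: atlas_smooth.
have xE : fwd z' (pb_proj b) = T x by rewrite /T /transition /= chart_fwdK.
have in0 := proj_dom_fwd aphi dphi dz.
have pE : proj_loc (B := B) phi z (fwd phi b) = x by rewrite /proj_loc /= chart_fwdK.
have DE w : 'D_w (proj_loc (B := B) phi z') (fwd phi b) =
    'D_('D_w (proj_loc (B := B) phi z) (fwd phi b)) T x.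
  have dP : derivable (proj_loc (B := B) phi z) (fwd phi b) w.
    exact: smooth_mx_derivable (smooth_proj_loc aphi az) in0.
  have ox' : overlap z z' (proj_loc (B := B) phi z (fwd phi b)) by rewrite pE.
  have [+ _] := smooth_mx_chain oo sT ox' dP; rewrite pE => <-.
  apply: near_eq_derive; apply: (near_eq_open (open_proj_dom aphi az)) in0 => y.
  rewrite inE => -[Iy dy].
  by rewrite /proj_loc /T /transition /= chart_fwdK.
have [_ hT] := surf_holo az az'.
have tr u' v' := metric_trans g u' v' az az' ox.
rewrite !DE xE /hform -(hT x _ ox); congr (Complex _ _); exact: tr.
Qed.

Section Frame.
Variables (nabla : connection M) (z : chart R (2 + 2) M) (s : M -> B) (p : 'M[C]_3) (b : B).
Hypotheses (az : atlas z) (ad : adapted_section theta nabla z s) (pp : parabolic p).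
Hypotheses (dzb : chart_dom z (pb_proj b)) (bE : b = pb_act (s (pb_proj b)) p).
Let x := fwd z (pb_proj b).
Let Ux : chart_image z x. Proof. exact: chart_fwd. Qed.

Definition frame_metric : 'M[C]_2 := \matrix_(i, j)
  \sum_a \sum_c herm g z x a c * frame p a i * cc (frame p c j).

Lemma represents_frame_metric : represents_metric b frame_metric.
Proof.
move=> phi z' u v aphi az' dphi dzb'.
rewrite (hform_transition u v aphi az az' dphi dzb dzb') (hform_herm g az _ _ Ux).
pose th w i := theta phi (fwd phi b) w (up i) ord0.
have sol w a : dz a ('D_w (proj_loc (B := B) phi z) (fwd phi b)) =
    \sum_k frame p a k * th w k by exact: (soldering CC w a az ad pp dzb bE).
apply: etrans (_ : _ = \sum_a \sum_c herm g z x a c *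
    (\sum_k frame p a k * th u k) * cc (\sum_k frame p c k * th v k)) _.
  by apply: eq_bigr => a _; apply: eq_bigr => c _; rewrite !sol.
exact: (bilinear_change (herm g z x) (frame p) (th u) (th v)).
Qed.

Lemma frame_metric_conj i j : cc (frame_metric i j) = frame_metric j i.
Proof.
rewrite !mxE conjc_sum [RHS]exchange_big; apply: eq_bigr => a _.
rewrite conjc_sum; apply: eq_bigr => c _; rewrite !conjcM conjcK herm_conj//.
by move: (herm g z x c a) (cc (frame p a i)) (frame p c j) => *; ring.
Qed.

Lemma frame_metric_unit : frame_metric \in unitmx.
Proof.
have -> : frame_metric = (frame p)^T *m (\matrix_(a, c) herm g z x a c) *m map_mx cc (frame p).
  apply/matrixP => i j; rewrite !mxE exchange_big; apply: eq_bigr => c _.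
  rewrite !mxE mulr_suml; apply: eq_bigr => a _; rewrite !mxE.
  by congr (_ * _); rewrite mulrC.
have [Eu _] := mulmx1_unit (frameK pp).
by rewrite !unitmx_mul unitmx_tr Eu herm_unit// map_unitmx.
Qed.

(** The chart system is carried to [b] by the frame of [p], with [weyl_shifted] as the
    transformation law of [W]. *)
Lemma frame_metric_system L K W i j k l : levi_civita g nabla -> complex_linear nabla ->
  curvature_functions theta L K W ->
  \sum_s frame_metric s j * W b s i k l + \sum_s frame_metric s l * W b s i k j =
  cc (\sum_s frame_metric s k * W b s j l i + \sum_s frame_metric s i * W b s j l k).
Proof.
move=> LC CL hW.
have cws i' j' k' l' := @chart_weyl_system _ _ g nabla LC CL z az x
  (fun s i k l => - Dzb l (Pi3 nabla z s i k) x) _ i' j' k' l' (fun _ _ _ _ => erefl) erefl Ux.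
have E := weyl_system_frame (coframeK pp) cws
  (fun i' k' r t => weyl_shifted CC CL az ad pp dzb bE i' k' r t hW) i j k l.
have fE s' j' : frame_metric s' j' = \sum_a \sum_c
    (\matrix_(i, j) herm g z x i j) a c * frame p a s' * cc (frame p c j').
  by rewrite mxE; apply: eq_bigr => a _; apply: eq_bigr => c _; rewrite mxE.
have SE j' i' k' l' : \sum_s frame_metric s j' * W b s i' k' l' =
   \sum_s (\sum_a \sum_c (\matrix_(i, j) herm g z x i j) a c * frame p a s *
      cc (frame p c j')) * W b s i' k' l'.
  by apply: eq_bigr => s' _; rewrite fE.
by rewrite !SE; exact: E.
Qed.

End Frame.
End PulledBackMetric.

(** * Smoothness of determinants and adjugates *)

Section SmoothMatrices.
Context {R : realType} {V : normedModType R}.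
Local Notation C := R[i].

Lemma det2E (A : 'M[C]_2) : \det A = A 0 0 * A 1 1 - A 0 1 * A 1 0.
Proof.
rewrite (expand_det_row A 0) big_ord_recl big_ord1 /cofactor !det_mx11 !mxE /=.
have -> : lift ord0 ord0 = 1 :> 'I_2 by exact: val_inj.
have -> : lift (1 : 'I_2) ord0 = 0 by exact: val_inj.
by rewrite expr0 expr1 mul1r mulN1r mulrN.
Qed.

Lemma csmooth_prod (U : set V) (I : Type) (r : seq I) (f : I -> V -> C) : open U ->
  (forall i, csmooth U (f i)) -> csmooth U (fun x => \prod_(i <- r) f i x).
Proof.
move=> oU sf; elim: r => [|i r IH].
  by apply: csmooth_eq (csmooth_cst U 1) => // x _; rewrite big_nil.
by apply: csmooth_eq (csmoothM oU (sf i) IH) => // x _; rewrite big_cons.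
Qed.

Lemma csmooth_det n (U : set V) (A : V -> 'M[C]_n) : open U ->
  (forall i j, csmooth U (fun x => A x i j)) -> csmooth U (fun x => \det (A x)).
Proof.
move=> oU sA; rewrite /determinant; apply: csmooth_sum => // s.
by apply: csmoothM => //; [exact: csmooth_cst|exact: csmooth_prod].
Qed.

Lemma csmooth_adj n (U : set V) (A : V -> 'M[C]_n) i j : open U ->
  (forall i j, csmooth U (fun x => A x i j)) -> csmooth U (fun x => (\adj (A x)) i j).
Proof.
move=> oU sA.
have S : csmooth U (fun x => (-1) ^+ (j + i) * \det (row' j (col' i (A x)))).
  apply: csmoothM => //; first exact: csmooth_cst.
  apply: csmooth_det => // k l.
  by apply: csmooth_eq (sA (lift j k) (lift i l)) => // x _; rewrite !mxE.
by apply: csmooth_eq S => // x _; rewrite mxE.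
Qed.

Lemma open_csmooth_neq0 (U : set V) (f : V -> C) : open U -> csmooth U f ->
  open (U `&` [set x | f x != 0]).
Proof.
move=> oU [sR sI].
pose n x := complex.Re (f x) * complex.Re (f x) + complex.Im (f x) * complex.Im (f x).
have sn : smooth_on U n by apply: smoothD => //; exact: smoothM.
have nE x : (f x != 0) = (n x != 0).
  rewrite /n -!expr2 paddr_eq0 ?sqr_ge0// !sqrf_eq0 eq_complex.
  by [].
rewrite openE => x [Ux fx]; apply: filterI; first exact: open_nbhs_nbhs.
have cn : {for x, continuous n} by exact: smooth_continuous sn Ux.
have nx : n x != 0 by rewrite -nE.
have H : nbhs x (n @^-1` [set y | y != 0]).
  by apply: cn; apply: open_nbhs_nbhs; split=> //; exact: open_neq.
by apply: filterS H => y /=; rewrite nE.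
Qed.

End SmoothMatrices.

(** * Smoothness of the metric components on [B] *)

Section SmoothPulledBackMetric.
Context {R : realType} (M : complex_surface R) (B : principal_bundle M).
Local Notation C := R[i].
Local Notation cc := (@conjc R).
Variable theta : mxform B.
Hypothesis CC : cartan_connection theta.
Variables (g : kahler_metric M).

(** As [h] may come from a pointwise choice, smoothness is recovered from its defining identity. On
    the vectors [u k], constant in the chart, it reads Gm = Th^T h conj(Th) and is solved for [h]
    where [Th] is invertible. *)
Lemma smooth_represents_metric (h : B -> 'M[C]_2) :
  (forall b, represents_metric theta g b (h b)) -> smooth_cmx_fun setT h.
Proof.
move=> hP phi aphi i j.
change (csmooth (fwd phi @` (setT `&` chart_dom phi)) (fun x => h (bwd phi x) i j)).
apply: csmooth_local => _ [b [_ db] <-].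
have [z az dzb] := atlas_cover (pb_proj b).
have [u uE] := choice (fun k => dual_vector CC k aphi db).
have oP := open_proj_dom aphi az; have sP := smooth_proj_loc aphi az.
pose O := proj_dom (B := B) phi z; pose P := proj_loc (B := B) phi z.
pose Th x : 'M[C]_2 := \matrix_(a, k) theta phi x (u k) (up a) ord0.
have sTh a k : csmooth O (fun x => Th x a k).
  have S : csmooth (chart_image phi) (fun x => theta phi x (u k) (up a) ord0).
    exact: cartan_smooth CC _ (u k) aphi _ _.
  apply: csmooth_eq (csmooth_sub _ S) => //; first by move=> x _; rewrite mxE.
  by move=> x [].
(* The base point belongs to this set, since [Th] is the identity there by the choice of the
   [u k]. *)
pose O' := O `&` [set x | \det (Th x) != 0].
have oO' : open O' by apply: open_csmooth_neq0 => //; exact: csmooth_det.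
exists O'; split.
  split; first exact: proj_dom_fwd.
  rewrite /= (_ : Th _ = 1%:M) ?det1 ?oner_neq0//.
  by apply/matrixP => a k; rewrite !mxE uE.
have sub : O' `<=` O by move=> x [].
pose Gm x k l := \sum_a \sum_c
  herm g z (P x) a c * dz a ('D_(u k) P x) * cc (dz c ('D_(u l) P x)).
have sdz a k : csmooth O (fun x => dz a ('D_(u k) P x)).
  have S e : smooth_on O (fun x => ('D_(u k) P x) 0 e).
    apply: smooth_eq (smooth_derive (u k) (sP 0 e)) => // x; rewrite inE => Ox.
    by rewrite (smooth_mx_deriveE _ _ sP Ox).
  by split; exact: S.
have sG k l : csmooth O (fun x => Gm x k l).
  apply: csmooth_sum => // a; apply: csmooth_sum => // c.
  apply: csmoothM => //; last by apply: csmooth_conj.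
  apply: csmoothM => //.
  apply: (csmooth_comp oP (atlas_open az) _ sP (csmooth_herm g az a c)).
  by move=> x [Ix dx]; exact: chart_fwd.
(* Cramer's rule: [N] is the inverse of [Th] on [O'], written with smooth entries. *)
pose N x k a := (\det (Th x))^-1 * (\adj (Th x)) k a.
have sN k a : csmooth O' (fun x => N x k a).
  apply: csmoothM => //.
    apply: csmoothV => //; first by move=> x [].
    by apply: csmooth_sub sub _; exact: csmooth_det.
  by apply: csmooth_sub sub _; exact: csmooth_adj.
have S : csmooth O' (fun x => \sum_k \sum_l N x k i * Gm x k l * cc (N x l j)).
  apply: csmooth_sum => // k; apply: csmooth_sum => // l.
  apply: csmoothM => //; last by apply: csmooth_conj.
  by apply: csmoothM => //; exact: csmooth_sub sub _.
apply: csmooth_eq S => // x; rewrite inE => -[[Ix dx] detx].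
have [d1 E1] := chart_bwd aphi Ix.
have Tu : Th x \in unitmx by rewrite unitmxE unitfE.
have NE k a : N x k a = invmx (Th x) k a by rewrite /invmx Tu mxE.
have GE k l : Gm x k l = ((Th x)^T *m h (bwd phi x) *m map_mx cc (Th x)) k l.
  have Iz : chart_image z (P x) by exact: chart_fwd.
  rewrite /Gm -(hform_herm g az _ _ Iz).
  have := hP (bwd phi x) phi z (u k) (u l) aphi az d1 dx; rewrite E1 => ->.
  rewrite !mxE exchange_big; apply: eq_bigr => c _; rewrite !mxE mulr_suml.
  by apply: eq_bigr => a _; rewrite !mxE; congr (_ * _); rewrite mulrC.
have hE : (invmx (Th x))^T *m ((Th x)^T *m h (bwd phi x) *m map_mx cc (Th x)) *m
    map_mx cc (invmx (Th x)) = h (bwd phi x).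
  rewrite !mulmxA -trmx_mul mulmxV// trmx1 mul1mx -mulmxA -map_mxM mulmxV//.
  by rewrite map_mx1 mulmx1.
rewrite -[in RHS]hE mxE exchange_big; apply: eq_bigr => l _; rewrite mxE mulr_suml.
by apply: eq_bigr => k _; rewrite GE !NE !mxE.
Qed.

End SmoothPulledBackMetric.

Theorem proposition3p2 (R : realType) (M : complex_surface R)
    (S : set (connection M)) (hS : cproj_structure S)
    (B : principal_bundle M) (theta : mxform B)
    (htheta : cartan_geometry_of S theta)
    (L : B -> 'I_2 -> R[i])
    (K : B -> 'I_2 -> 'I_2 -> 'I_2 -> R[i])
    (W : B -> 'I_2 -> 'I_2 -> 'I_2 -> 'I_2 -> R[i])
    (hW : curvature_functions theta L K W) :
  kahler_metrisable S ->
  exists h : B -> 'M[R[i]]_2,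
    [/\ smooth_cmx_fun setT h,
        forall b i j, conjc (h b i j) = h b j i,
        forall b, h b 0 0 * h b 1 1 - `|h b 0 1| ^+ 2 != 0
      & forall b i j k l,
        \sum_s conjc (h b j s) * W b s i k l +
        \sum_s conjc (h b l s) * W b s i k j =
        \sum_s h b k s * conjc (W b s j l i) +
        \sum_s h b i s * conjc (W b s j l k)].
Proof.
move=> [g [nabla [LC Snabla]]].
have CL : complex_linear nabla.
  by case: hS => nabla0 [_ SE]; move: Snabla; rewrite SE => -[].
have [CC adS] := htheta.
have local b : exists z s p, [/\ atlas z, adapted_section theta nabla z s, parabolic p,
    chart_dom z (pb_proj b) & b = pb_act (s (pb_proj b)) p].
  have [z az dzb] := atlas_cover (pb_proj b).
  have [s [ad _]] := adS nabla z Snabla az.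
  have [ss sK _] := ad.
  have [p pp bE] := (pb_fibre (s (pb_proj b)) b).1 (sK _ dzb).
  by exists z, s, p.
have hex b : exists m, represents_metric theta g b m.
  have [z [s [p [az ad pp dzb bE]]]] := local b.
  by exists (frame_metric g z p b); exact: (represents_frame_metric CC g az ad pp dzb bE).
(* The choice is harmless: [represents_metric_unique] identifies [h b] with every frame metric at
   [b]. *)
have [h hP] := choice hex.
have hE b z s p : atlas z -> adapted_section theta nabla z s -> parabolic p ->
    chart_dom z (pb_proj b) -> b = pb_act (s (pb_proj b)) p -> h b = frame_metric g z p b.
  move=> az ad pp dzb bE; apply: (represents_metric_unique CC (hP b)).
  exact: (represents_frame_metric CC g az ad pp dzb bE).
have hc b i j : conjc (h b i j) = h b j i.
  have [z [s [p [az ad pp dzb bE]]]] := local b.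
  by rewrite (hE b z s p)// frame_metric_conj.
exists h; split => //; first exact: (smooth_represents_metric CC hP).
  move=> b; have [z [s [p [az ad pp dzb bE]]]] := local b.
  have : h b \in unitmx by rewrite (hE b z s p)// frame_metric_unit.
  (* For hermitian [h] the square of |h_01| is h_01 h_10, so the expression is the determinant. *)
  rewrite unitmxE unitfE det2E sqr_normc hc.
  by [].
move=> b i j k l; have [z [s [p [az ad pp dzb bE]]]] := local b.
have E := frame_metric_system CC az ad pp dzb bE i j k l LC CL hW.
rewrite -(hE b z s p)// in E.
(* Hermitian symmetry trades the conjugate of [h] for a transposition, which matches the index order
   of the claimed system. *)
have cE j' i' k' l' : \sum_s conjc (h b j' s) * W b s i' k' l' =
    \sum_s h b s j' * W b s i' k' l'.
  by apply: eq_bigr => s' _; rewrite hc.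
have cE' j' i' k' l' : conjc (\sum_s h b s j' * W b s i' k' l') =
    \sum_s h b j' s * conjc (W b s i' k' l').
  by rewrite conjc_sum; apply: eq_bigr => s' _; rewrite conjcM hc.
by rewrite !cE E conjcD !cE'.
Qed.
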